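(* Up to coordinate permutations there is a unique $(23,8,11)$-code of size $1288$; that is, such a code exists, and any two $(23,8,11)$-codes of size $1288$ can be obtained from one another by a permutation of the $23$ coordinate positions. An example is given by the set of words of weight $11$ in the binary Golay code.
   Context: Let $\mathbb{F}_2=\{0,1\}$ be the field of two elements. A word is an element of $\mathbb{F}_2^n$. The (Hamming) distance $d_H(u,v)$ of $u,v\in\mathbb{F}_2^n$ is the number of $i$ with $u_i\neq v_i$, and the weight of a word is its number of nonzero entries. A (binary) code is a subset of $\mathbb{F}_2^n$; its minimum distance is the minimum of $d_H(u,v)$ over distinct words $u,v$ of the code. An $(n,d,w)$-code is a set $C\subseteq\mathbb{F}_2^n$ of words all of weight $w$ with minimum distance at least $d$. The extended binary Golay code is the linear code of length $24$, dimension $12$ and minimum distance $8$ over $\mathbb{F}_2$ (unique up to coordinate permutation); the binary Golay code is the linear code of length $23$ obtained from it by deleting one coordinate position. *)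

(* Defs.v *)
From HB Require Import structures.
From mathcomp Require Import all_boot all_order all_algebra all_fingroup.
Set Implicit Arguments.
Unset Strict Implicit.
Unset Printing Implicit Defensive.
Import GRing.Theory.
Local Open Scope ring_scope.

Notation word n := 'rV['F_2]_n.
Notation code n := {set 'rV['F_2]_n}.

Definition hamming n (u v : word n) : nat := #|[set i | u 0 i != v 0 i]|.

Definition weight n (u : word n) : nat := #|[set i | u 0 i != 0]|.

(* Codes with at most one word, for which the minimum is taken over the empty
   set, satisfy this for every d. *)
Definition min_dist_ge n (C : code n) (d : nat) : Prop :=
  forall u v, u \in C -> v \in C -> u != v -> (d <= hamming u v)%N.

Definition has_min_dist n (C : code n) (d : nat) : Prop :=
  min_dist_ge C d /\
  exists u v, [/\ u \in C, v \in C, u != v & hamming u v = d].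

Definition constant_weight_code n (d w : nat) (C : code n) : Prop :=
  (forall u, u \in C -> weight u = w) /\ min_dist_ge C d.

Definition permute_code n (s : 'S_n) (C : code n) : code n :=
  [set col_perm s u | u in C].

Definition code_of n (V : {vspace word n}) : code n := [set u | u \in V].

Definition is_extended_golay (V : {vspace word 24}) : Prop :=
  \dim V = 12 /\ has_min_dist (code_of V) 8.

Definition puncture n (i : 'I_n) (C : code n) : code n.-1 :=
  [set col' i u | u in C].

(* As the extended Golay code is only determined up to a permutation of the
   coordinates, being a Golay code is a predicate. *)
Definition is_golay (B : code 23) : Prop :=
  exists (V : {vspace word 24}) (i : 'I_24),
    is_extended_golay V /\ B = puncture i (code_of V).

Definition words_of_weight n (w : nat) (C : code n) : code n :=
  [set u in C | weight u == w].

(* Main.v *)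
(* Let C be a (23,8,11)-code of size 1288, viewed as a family of 11-subsets. For
   u in C the group S_11 x S_12 stabilising u supplies positive semidefinite
   kernels K_u(v,w), and the sums of K_u(v,w) over u, v, w in C are nonnegative.
   A suitable combination (a dual solution of Schrijver's semidefinite program)
   has, once symmetrised in u, v, w, nonpositive coefficients on all triples of
   distinct words; this leaves too little room for a single pair of words whose
   intersection size is not 3, 5 or 7.

   Hence, after a parity bit has been added, the words of C have weight 12 and
   pairwise even intersections, so their span E is doubly even and self-orthogonal.
   It has more than 2^11 elements, so it is self-dual of dimension 12, and a word
   of weight 4 would force |C| <= 1280. So E is a [24,12,8] code, and C consists
   of all words of weight 11 of the punctured, perfect, [23,12,7] code, because
   sphere counting shows that there are exactly 1288 of those.

   For the uniqueness of E fix an octad O through the added point. The 32 words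
   disjoint from O form a first order Reed-Muller code and label the other 16
   points by F_2^4. The words meeting O in {0,j}, for j = 1, ..., 7, then yield
   seven quadratic forms which, like their pairwise sums, are bent: a 7-clique in
   a graph on the 28 nondegenerate alternating forms. There are eight such cliques,
   and all eight give the same code up to coordinate permutations. *)

Require Import Defs.
From HB Require Import structures.
From Stdlib Require Import ZArith.
From mathcomp Require Import all_boot all_order all_algebra all_fingroup finfield.
From mathcomp Require Import ssrZ zify ring.
Set Implicit Arguments.
Unset Strict Implicit.
Unset Printing Implicit Defensive.
Import Order.TTheory GRing.Theory Num.Theory.
Local Open Scope ring_scope.

(** * Positive semidefinite kernels *)

Section PositiveKernels.

Variables (R : realDomainType) (T : finType).
Implicit Types (C : {set {set T}}) (X u v w : {set T}) (K : {set T} -> {set T} -> R).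

Definition psd C K :=
  forall phi : {set T} -> R,
    0 <= \sum_(v in C) \sum_(w in C) phi v * phi w * K v w.

Definition jump v x y : R := (x \in v)%:R - (y \in v)%:R.

(* On sets of fixed size, products of k factors [(x \in v) - (y \in v)] over
   disjoint pairs {x,y} span the harmonic functions of degree k; this is the Gram
   kernel of all of them, so its values are dual Hahn polynomials up to scaling. *)
Fixpoint hahn_kernel k X K v w : R :=
  if k is k'.+1 then
    \sum_(x in X) \sum_(y in X)
      jump v x y * jump w x y * hahn_kernel k' (X :\ x :\ y) K v w
  else K v w.

(** The arguments count the points of [X] in both sets, only in [v], only in [w], and in neither. A
    pair x, y has jump product 1 if one point lies in both sets and the other in neither, -1 if one
    lies only in [v] and the other only in [w], and 0 otherwise. The factor 2 accounts for the order
    of x and y. *)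
Fixpoint hahn k a b c d : R :=
  if k is k'.+1 then
    2 * (a%:R * d%:R * hahn k' a.-1 b c d.-1
         - b%:R * c%:R * hahn k' a b.-1 c.-1 d)
  else 1.

(** For fixed x and y the jump factors are a function of [v] times the same function of [w], so they
    are absorbed into the test function [phi]. *)
Lemma psd_hahn_kernel C k X K : psd C K -> psd C (hahn_kernel k X K).
Proof.
move=> psdK; elim: k X => [|k IHk] X phi //=.
under eq_bigr do under eq_bigr do rewrite mulr_sumr.
under eq_bigr do rewrite exchange_big /=.
rewrite exchange_big /=; apply: sumr_ge0 => x _.
under eq_bigr do under eq_bigr do rewrite mulr_sumr.
under eq_bigr do rewrite exchange_big /=.
rewrite exchange_big /=; apply: sumr_ge0 => y _.
have := IHk (X :\ x :\ y) (fun v => phi v * jump v x y).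
congr (0 <= _); apply: eq_bigr => v _; apply: eq_bigr => w _.
by ring.
Qed.

Lemma sum_cells (A B X : {set T}) (h : T -> T -> R) (e : R) :
  A \subset X -> B \subset X -> {in A & B, forall x y, h x y = e} ->
  \sum_(x in X) \sum_(y in X) ((x \in A) && (y \in B))%:R * h x y =
  #|A|%:R * #|B|%:R * e.
Proof.
move=> sAX sBX he.
transitivity (\sum_(x in A) \sum_(y in B) e); last first.
  by rewrite !sumr_const -[LHS]mulr_natl -[e *+ _]mulr_natl mulrA.
rewrite [LHS](big_setID A) /= [X in _ + X]big1 ?addr0; last first.
  by move=> x /setDP[_ /negbTE->]; rewrite big1 // => y _; rewrite mul0r.
rewrite (setIidPr sAX); apply: eq_bigr => x Ax.
rewrite [LHS](big_setID B) /= [X in _ + X]big1 ?addr0; last first.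
  by move=> y /setDP[_ /negbTE->]; rewrite andbF mul0r.
rewrite (setIidPr sBX); apply: eq_bigr => y By.
by rewrite Ax By mul1r he.
Qed.

Definition cell v w (s : bool * bool) X := [set x in X | (x \in v, x \in w) == s].

Lemma card_cellD v w s1 s2 s X x y :
    s1 != s2 -> x \in cell v w s1 X -> y \in cell v w s2 X ->
  #|cell v w s (X :\ x :\ y)| = (#|cell v w s X| - (s1 == s) - (s2 == s))%N.
Proof.
move=> ne12; rewrite !inE => /andP[xX /eqP xs] /andP[yX /eqP ys].
have yx : y != x by apply: contra_neq ne12 => yx; rewrite -xs -ys yx.
have -> : cell v w s (X :\ x :\ y) = cell v w s X :\ x :\ y.
  by apply/setP=> z; rewrite !inE !andbA.
rewrite (cardsD1 x (cell v w s X)) !inE xX xs addKn.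
by rewrite (cardsD1 y (_ :\ x)) !inE yX yx ys addKn.
Qed.

Lemma jumpM v w x y : jump v x y * jump w x y =
  ((x \in v, x \in w) == (true, true))%:R * ((y \in v, y \in w) == (false, false))%:R
  + ((x \in v, x \in w) == (false, false))%:R * ((y \in v, y \in w) == (true, true))%:R
  - ((x \in v, x \in w) == (true, false))%:R * ((y \in v, y \in w) == (false, true))%:R
  - ((x \in v, x \in w) == (false, true))%:R * ((y \in v, y \in w) == (true, false))%:R.
Proof.
rewrite /jump; case: (x \in v); case: (x \in w); case: (y \in v); case: (y \in w);
  by rewrite /= ?eqxx; ring.
Qed.

Lemma hahn_kernelE k X K v w :
  hahn_kernel k X K v w =
  hahn k #|cell v w (true, true) X| #|cell v w (true, false) X|
         #|cell v w (false, true) X| #|cell v w (false, false) X| * K v w.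
Proof.
elim: k X => [|k IHk] X /=; first by rewrite mul1r.
pose h x y := hahn_kernel k (X :\ x :\ y) K v w.
pose c s := #|cell v w s X|.
have part s1 s2 : s1 != s2 ->
    \sum_(x in X) \sum_(y in X) ((x \in v, x \in w) == s1)%:R
       * ((y \in v, y \in w) == s2)%:R * h x y =
    (c s1)%:R * (c s2)%:R *
    (hahn k (c (true, true) - (s1 == (true, true)) - (s2 == (true, true)))
            (c (true, false) - (s1 == (true, false)) - (s2 == (true, false)))
            (c (false, true) - (s1 == (false, true)) - (s2 == (false, true)))
            (c (false, false) - (s1 == (false, false)) - (s2 == (false, false)))
    * K v w).
  move=> ne12; rewrite -(@sum_cells _ _ X h); first last.
  - by move=> x y xs ys; rewrite /h IHk !(card_cellD _ ne12 xs ys).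
  - by apply/subsetP=> x; rewrite inE => /andP[].
  - by apply/subsetP=> x; rewrite inE => /andP[].
  apply: eq_bigr => x xX; apply: eq_bigr => y yX.
  by rewrite !inE xX yX /= -natrM mulnb.
under eq_bigr do under eq_bigr do rewrite jumpM !mulrDl !mulNr.
under eq_bigr do rewrite !(big_split, sumrN) /=.
rewrite !(big_split, sumrN) /= !part //= -/(c _).
rewrite !subn0 !subn1; ring.
Qed.

End PositiveKernels.

(** * Intersection sizes *)

Section Certificate.

Local Open Scope Z_scope.

(* Entry (k, l, rows) stands for the positive semidefinite matrix given by the sum
   of the squares of the linear forms in [rows], in the block of degree k on u and
   degree l on its complement. The rows are Cholesky factors of a numerical strictly
   feasible solution, multiplied by 2^40 and rounded. *)
Definition certificate : seq (nat * nat * seq (seq Z)) := [::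
  (0%N, 0%N, [::
    [:: 5812042138861922; 1569994562204585; 579279610369174; 170520034140329; 11336328014664; -42269236385356; -49461705045665; 16179729928202; 2118700513077];
    [:: 0; 2295573466983496; 539207050281374; 73283542913023; -3870467448704; -8798084401706; -47478112921826; -15516769304000; -3167875976516];
    [:: 0; 0; 334162463961557; 187096217140006; 47917652421879; -30997317837207; -40818523375918; -19050340975643; -34387574382940];
    [:: 0; 0; 0; 98262061585587; 54864614550785; 212583115782; -23393178775213; -49385808252534; -84289261488930];
    [:: 0; 0; 0; 0; 50289735275194; 43522907094307; -33179023200193; -103910212900496; -179772164030658];
    [:: 0; 0; 0; 0; 0; 8723193618848; 13053505808694; -17948640035531; -985718131343518];
    [:: 0; 0; 0; 0; 0; 0; 4917694218721; 7444903503443; -2456818166021022];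
    [:: 0; 0; 0; 0; 0; 0; 0; 10764860125598; -3552403834132679];
    [:: 0; 0; 0; 0; 0; 0; 0; 0; 68841919972]]);
  (0%N, 1%N, [::
    [:: 909799642439392; 169901075613971; 46047896087643; 4804136472011; 2075628697; 646018881460; -2777569122570; -2199467223986];
    [:: 0; 605661781835940; 148514782506635; 17133101320827; 938443950882; 3679112183447; -6209900882356; -6014878249855];
    [:: 0; 0; 127401477217002; 69589924858260; 20367515630327; -9171148049468; -14701628562981; 11517035548657];
    [:: 0; 0; 0; 27858895944724; 9933230191916; -1131516174996; 1645652027085; 3607716583924];
    [:: 0; 0; 0; 0; 8575817088288; 11847449490072; 10744534376231; 9736191775201];
    [:: 0; 0; 0; 0; 0; 3193934009052; 5582628711149; 5978374491467];
    [:: 0; 0; 0; 0; 0; 0; 3700407394538; 7762701187825];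
    [:: 0; 0; 0; 0; 0; 0; 0; 6036912920504]]);
  (0%N, 2%N, [::
    [:: 0; 96883831515903; 21688388103607; 13664325741543; 2088254177922; -1899951968841; -3693172177592; -7122591675142];
    [:: 0; 0; 27297036030220; 5204134657767; -2842041622416; -1654593823905; 2773810662492; 4437939118316];
    [:: 0; 0; 0; 4724279945969; 4203977961778; 2826290039593; 363320984009; -2383231896068];
    [:: 0; 0; 0; 0; 2420221468498; 977539084312; -824198179402; -770442884600];
    [:: 0; 0; 0; 0; 0; 1866707928928; 2941470640570; 2062107293831];
    [:: 0; 0; 0; 0; 0; 0; 634683330385; 1351289688497];
    [:: 0; 0; 0; 0; 0; 0; 0; 664172601235]]);
  (0%N, 3%N, [::
    [:: 0; 0; 11620607367790; 5211229758975; 589049415092; -434098267828; -222389124351; 1290636641996];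
    [:: 0; 0; 0; 275882335842; 40500934694; 43900930435; 66736524623; 110688327866];
    [:: 0; 0; 0; 0; 520352057946; 485326984245; 316657733478; 151715822352];
    [:: 0; 0; 0; 0; 0; 146430070979; 262027433498; 278966710764];
    [:: 0; 0; 0; 0; 0; 0; 93391939677; 50966877375];
    [:: 0; 0; 0; 0; 0; 0; 0; 180927164968]]);
  (0%N, 4%N, [::
    [:: 0; 0; 0; 360661363822; -73143445179; 152141386103; 335225937973; 360661377887];
    [:: 0; 0; 0; 0; 318669818559; 208028790610; 57984530858; -9929];
    [:: 0; 0; 0; 0; 0; 18485170263; 14869301919; -123];
    [:: 0; 0; 0; 0; 0; 0; 20511916930; 627];
    [:: 0; 0; 0; 0; 0; 0; 0; 6105033]]);
  (1%N, 0%N, [::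
    [:: 0; 930158584058708; 283096092276479; 59742942532924; 1111300016308; 1553044321092; -9026297174142; -180300502584];
    [:: 0; 0; 102213195866081; 40486472717071; 8803857685519; -7896076488544; -8210053080443; 8895814213093];
    [:: 0; 0; 0; 23964469850803; 8190348962453; -5731029458195; 2446461611134; 6960664764722];
    [:: 0; 0; 0; 0; 12286129157305; 17147901398316; 9787902731331; -3645788498092];
    [:: 0; 0; 0; 0; 0; 4388892656457; 6799888147670; 4579321549477];
    [:: 0; 0; 0; 0; 0; 0; 6609017728896; 12128673958803];
    [:: 0; 0; 0; 0; 0; 0; 0; 6474360015902]]);
  (1%N, 1%N, [::
    [:: 0; 75044341768673; 6264241196992; 10025218484745; 1407285912868; -1468008940238; -2896704364403; -7934437210530];
    [:: 0; 0; 46771080312905; 9861832064313; 1007020687686; 295414931402; -3532072671638; 3444462321931];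
    [:: 0; 0; 0; 5568173678844; 2286990460066; 1644257364047; 3669228472616; 5119409831844];
    [:: 0; 0; 0; 0; 5656939847390; 27574430857; -2809908959615; -4838599401844];
    [:: 0; 0; 0; 0; 0; 2172450771236; 3379325692837; 6394940952478];
    [:: 0; 0; 0; 0; 0; 0; 2054183570249; 2752004195384];
    [:: 0; 0; 0; 0; 0; 0; 0; 1919058265578]]);
  (1%N, 3%N, [::
    [:: 0; 0; 2338136477447; -703141231576; -108133172786; 12522952587; 125276916791; 527726089286];
    [:: 0; 0; 0; 276514591582; 244746669916; 159293351693; 190683741986; 131200231922];
    [:: 0; 0; 0; 0; 25993250203; 16573964925; 30134778017; 28340308661];
    [:: 0; 0; 0; 0; 0; 14514689035; 23408026652; 26516702591];
    [:: 0; 0; 0; 0; 0; 0; 25535927318; 3118432372];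
    [:: 0; 0; 0; 0; 0; 0; 0; 17955630430]]);
  (2%N, 0%N, [::
    [:: 0; 0; 94440913951509; 23445332468316; 1212606525266; -986662433681; -1151120496197; -511979909860];
    [:: 0; 0; 0; 8787525088760; 5710562776616; -757474518774; -5205809045503; -8576440733319];
    [:: 0; 0; 0; 0; 2576275754212; 1381376769138; 2764200956522; -713239434938];
    [:: 0; 0; 0; 0; 0; 4829705436920; 4415472281207; 2543874401607];
    [:: 0; 0; 0; 0; 0; 0; 1029811138689; 1330848802777];
    [:: 0; 0; 0; 0; 0; 0; 0; 1846396124527]]);
  (2%N, 1%N, [::
    [:: 0; 0; 1940923723334; -1444241256164; 362567811176; -11756293909; 534556119547; 478634162500];
    [:: 0; 0; 0; 3963326782827; 475827374886; 102173402486; -290725608909; -1485822370136];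
    [:: 0; 0; 0; 0; 749586486348; 216167692827; -168083306434; -1103041200376];
    [:: 0; 0; 0; 0; 0; 378232449557; -56204147112; 679879535300];
    [:: 0; 0; 0; 0; 0; 0; 921129063902; 426785888101];
    [:: 0; 0; 0; 0; 0; 0; 0; 181956764133]]);
  (3%N, 0%N, [::
    [:: 0; 0; 0; 3811547045960; 1324556870927; -344470775565; -24355249905; 558715886680];
    [:: 0; 0; 0; 0; 1409303344212; 791518799694; -257982409028; -1774915570470];
    [:: 0; 0; 0; 0; 0; 549593710331; 1049196174051; 1590778565856];
    [:: 0; 0; 0; 0; 0; 0; 188699548926; 337263555261];
    [:: 0; 0; 0; 0; 0; 0; 0; 175318678942]]);
  (3%N, 1%N, [::
    [:: 0; 0; 0; 308498949477; -154478255195; 139760511066; 123603324581; 308498958072];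
    [:: 0; 0; 0; 0; 213829459778; 48725330505; 91123093912; -4188];
    [:: 0; 0; 0; 0; 0; 14518030279; -91553459386; -935];
    [:: 0; 0; 0; 0; 0; 0; 135493044719; 1687];
    [:: 0; 0; 0; 0; 0; 0; 0; 4305492]]);
  (4%N, 0%N, [::
    [:: 0; 0; 0; 0; 256609790859; 152962277940; 101146901385; -282899789568];
    [:: 0; 0; 0; 0; 0; 242281258361; 400452894596; 930261902485];
    [:: 0; 0; 0; 0; 0; 0; 28520960586; 43616725765];
    [:: 0; 0; 0; 0; 0; 0; 0; 87625079789]])].

(* Lagrange multipliers m_i for the equations sum_{u,v} m(u,v) (|C| - 1288) = 0,
   indexed by the size i of the intersection of u and v. *)
Definition multiplier : seq Z :=
  [:: 124872292736491471664740040704;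
      40843702270173579795698286592;
      20134168909584418021618745344;
      6511866819590131128863817728;
      1207551894915118550726213632;
      636624701314103688659206144;
      1296417812273892033107591168;
      2885859989737843259036663808;
      15281886810073856775414611968].

Fixpoint hahnZ (k a b c d : nat) : Z :=
  if k is k'.+1 then
    2 * (Z.of_nat a * Z.of_nat d * hahnZ k' a.-1 b c d.-1
         - Z.of_nat b * Z.of_nat c * hahnZ k' a b.-1 c.-1 d)
  else 1.

(* The eight cells of the Venn diagram of three 11-subsets of a 23-set, in terms
   of the sizes i, j, t of the pairwise intersections and s of the triple one. *)
Definition split_hahn (k l i j t s : nat) : Z :=
  hahnZ k s (i - s) (j - s) (11 + s - i - j) *
  hahnZ l (t - s) (11 + s - i - t) (11 + s - j - t) (i + j + t - s - 10).

(* The possible intersection sizes 0, ..., 7, 11 are stored at 0, ..., 8. *)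
Definition entry (r : seq Z) (i : nat) : Z := nth 0 r (minn i 8).

Definition block_value (i j t s : nat) (b : nat * nat * seq (seq Z)) : Z :=
  split_hahn b.1.1 b.1.2 i j t s *
  foldr (fun r z => entry r i * entry r j + z) 0 b.2.

Definition kernel_value (i j t s : nat) : Z :=
  foldr (fun b z => block_value i j t s b + z) 0 certificate.

(** Each of the three words takes the role of the distinguished word once, because only the
    symmetrised kernel can be bounded term by term. *)
Definition triple_value (i j t s : nat) : Z :=
  kernel_value i j t s + kernel_value i t j s + kernel_value j t i s
  + entry multiplier i + entry multiplier j + entry multiplier t.

(* A triple with u = v = w is bounded by three terms [pair_bound 11]; hence the
   division, rounded up. *)
Definition pair_bound (i : nat) : Z :=
  if i == 11%N then triple_value 11 11 11 11 / 3 + 1 else triple_value i i 11 i.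

(** The multiplier of a pair is counted once for each of the 1288 choices of a third word.
    Nonnegativity of the kernel sums makes the sum of the excesses over all pairs nonnegative. *)
Definition pair_excess (i : nat) : Z := pair_bound i - 1288 * entry multiplier i.

Definition sizes : seq nat := [:: 0; 1; 2; 3; 4; 5; 6; 7; 11]%N.

(** These inequalities make the cells of the Venn diagram nonnegative; the cell outside all three
    sets has 23 - 33 + i + j + t - s points. *)
Definition realizable (i j t s : nat) : bool :=
  [&& s <= i, s <= j, s <= t, i + j <= 11 + s, i + t <= 11 + s, j + t <= 11 + s
    & s + 10 <= i + j + t]%N.

Definition pair_boundif (b : bool) (i : nat) : Z := if b then pair_bound i else 0.

(** Size 11 marks equal words. When two words of a triple coincide, the triple is charged to the
    pair that remains; for three distinct words the bound is 0. *)
Definition triple_check : bool :=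
  all (fun i => all (fun j => all (fun t => all (fun s =>
    if realizable i j t s then
      triple_value i j t s <=?
        pair_boundif (t == 11%N) i + pair_boundif (j == 11%N) i
        + pair_boundif (i == 11%N) j
    else true)
    (iota 0 12)) sizes) sizes) sizes.

(** The last condition says that a single pair of bad intersection size outweighs the diagonal
    contribution of all 1288 words. *)
Definition pair_check : bool :=
  all (fun i => pair_excess i <=? 0) [:: 3; 5; 7]%N &&
  all (fun i => (pair_excess i <=? 0) && (1288 * pair_excess 11 + pair_excess i <? 0))
    [:: 0; 1; 2; 4; 6]%N.

Lemma triple_checkT : triple_check. Proof. by vm_cast_no_check (erefl true). Qed.

Lemma pair_checkT : pair_check. Proof. by vm_cast_no_check (erefl true). Qed.

End Certificate.

Lemma foldr_sumZ (I : Type) (r : seq I) (F : I -> Z) :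
  foldr (fun x z => Z.add (F x) z) 0 r = \sum_(x <- r) F x.
Proof. by elim: r => [|x r IHr] /=; rewrite ?big_nil ?big_cons ?IHr. Qed.

Lemma block_valueE i j t s b :
  block_value i j t s b =
  \sum_(r <- b.2) split_hahn b.1.1 b.1.2 i j t s * (entry r i * entry r j).
Proof. by rewrite /block_value foldr_sumZ; exact: mulr_sumr. Qed.

Lemma hahnZE k a b c d : hahnZ k a b c d = hahn Z k a b c d.
Proof.
have ofnat n : Z.of_nat n = n%:R :> Z.
  by elim: n => // n IHn; rewrite Nat2Z.inj_succ IHn -Z.add_1_l mulrS.
by elim: k a b c d => //= k IHk a b c d; rewrite !IHk !ofnat.
Qed.

Section Triples.

Implicit Types (C : {set {set 'I_23}}) (u v w : {set 'I_23}).

Lemma card_cell_in u v w :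
  [/\ #|cell v w (true, true) u| = #|u :&: v :&: w|,
      #|cell v w (true, false) u| = (#|u :&: v| - #|u :&: v :&: w|)%N,
      #|cell v w (false, true) u| = (#|u :&: w| - #|u :&: v :&: w|)%N
    & #|cell v w (false, false) u| =
      (#|u| + #|u :&: v :&: w| - #|u :&: v| - #|u :&: w|)%N].
Proof.
have c11 : cell v w (true, true) u = u :&: v :&: w.
  by apply/setP=> x; rewrite !inE -andbA; do !case: (_ \in _).
have c10 : cell v w (true, false) u = u :&: v :\: w.
  by apply/setP=> x; rewrite !inE; do !case: (_ \in _).
have c01 : cell v w (false, true) u = u :&: w :\: v.
  by apply/setP=> x; rewrite !inE; do !case: (_ \in _).
have c00 : cell v w (false, false) u = u :\: v :\: w.
  by apply/setP=> x; rewrite !inE; do !case: (_ \in _).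
have := cardsID w (u :&: v); have := cardsID v (u :&: w).
have := cardsID w (u :\: v); have := cardsID v u.
have -> : u :&: w :&: v = u :&: v :&: w by rewrite setIAC.
have -> : (u :\: v) :&: w = u :&: w :\: v by rewrite setIDAC.
by rewrite c11 c10 c01 c00; split; lia.
Qed.

Lemma split_hahnE k l u v w : #|u| = 11%N -> #|v| = 11%N -> #|w| = 11%N ->
  split_hahn k l #|u :&: v| #|u :&: w| #|v :&: w| #|u :&: v :&: w| =
  hahn_kernel k u (hahn_kernel l (~: u) (fun _ _ => 1 : Z)) v w.
Proof.
move=> cu cv cw; rewrite !hahn_kernelE mulr1 /split_hahn !hahnZE.
have [-> -> -> ->] := card_cell_in u v w.
have [-> -> -> ->] := card_cell_in (~: u) v w.
have := cardsID u v; have := cardsID u w; have := cardsID u (v :&: w).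
have := cardsC u; rewrite card_ord cu cv cw.
have -> : ~: u :&: v = v :\: u by rewrite setIC -setDE.
have -> : ~: u :&: w = w :\: u by rewrite setIC -setDE.
have -> : (v :\: u) :&: w = v :&: w :\: u by rewrite setIDAC.
rewrite ![_ :&: u]setIC !setIA.
by move=> c1 c2 c3 c4; congr (hahn _ _ _ _ _ _ * hahn _ _ _ _ _ _)%R; lia.
Qed.

(** Each row [r] of each block contributes the quadratic form of a Hahn kernel on [u] and its
    complement, evaluated at the test function [entry r #|u :&: v|]. *)
Lemma kernel_value_ge0 C u :
    #|u| = 11%N -> (forall v, v \in C -> #|v| = 11%N) ->
  0 <= \sum_(v in C) \sum_(w in C)
    kernel_value #|u :&: v| #|u :&: w| #|v :&: w| #|u :&: v :&: w|.
Proof.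
move=> cu cC; rewrite /kernel_value.
under eq_bigr do under eq_bigr do rewrite foldr_sumZ.
under eq_bigr do rewrite exchange_big /=.
rewrite exchange_big /=; apply: sumr_ge0 => -[[k l] rows] _.
under eq_bigr do under eq_bigr do rewrite block_valueE /=.
under eq_bigr do rewrite exchange_big /=.
rewrite exchange_big /=; apply: sumr_ge0 => r _.
have psd1 : psd C (fun _ _ => 1 : Z).
  move=> phi; rewrite (_ : \sum_(v in C) _ = (\sum_(v in C) phi v) ^+ 2) ?sqr_ge0 //.
  rewrite expr2 mulr_suml; apply: eq_bigr => v _; rewrite mulr_sumr.
  by apply: eq_bigr => w _; rewrite mulr1.
have := psd_hahn_kernel k u (psd_hahn_kernel l (~: u) psd1).
move=> /(_ (fun v => entry r #|u :&: v|)); congr (0 <= _).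
apply: eq_bigr => v vC; apply: eq_bigr => w wC.
by rewrite -split_hahnE ?(cC v) ?(cC w) //; apply: mulrC.
Qed.

(** Distinct words meet in at most 7 points, so size 11 detects equality, and the finite check
    applies to the sizes of any actual triple. *)
Lemma triple_value_le u v w :
    #|u| = 11%N -> #|v| = 11%N -> #|w| = 11%N ->
    (u != v -> #|u :&: v| <= 7)%N -> (u != w -> #|u :&: w| <= 7)%N ->
    (v != w -> #|v :&: w| <= 7)%N ->
  triple_value #|u :&: v| #|u :&: w| #|v :&: w| #|u :&: v :&: w| <=
    pair_boundif (v == w) #|u :&: v| + pair_boundif (u == w) #|u :&: v|
    + pair_boundif (u == v) #|u :&: w|.
Proof.
have size_in (x y : {set 'I_23}) : #|x| = 11%N -> (x != y -> #|x :&: y| <= 7)%N ->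
    #|x :&: y| \in sizes /\ (#|x :&: y| == 11%N) = (x == y).
  move=> cx le7; have [<-|/le7 {}le7] := eqVneq x y; first by rewrite setIid cx.
  by move: le7; case: #|_| => [|[|[|[|[|[|[|[|]]]]]]]].
move=> cu cv cw uv uw vw.
have [iS <-] := size_in u v cu uv; have [jS <-] := size_in u w cu uw.
have [tS <-] := size_in v w cv vw.
have sS : #|u :&: v :&: w| \in iota 0 12.
  by rewrite mem_iota (leq_ltn_trans (subset_leq_card (subsetIr _ _))) ?cw.
have /allP/(_ _ iS)/allP/(_ _ jS)/allP/(_ _ tS)/allP/(_ _ sS) := triple_checkT.
rewrite (_ : realizable _ _ _ _) //.
have sub (A B : {set 'I_23}) : A \subset B -> (#|A| <= #|B|)%N by apply: subset_leq_card.
have := cardsUI u v; have := cardsUI u w; have := cardsUI v w.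
have := cardsUI (u :|: v) w.
have := cardsUI (u :&: w) (v :&: w); rewrite -setIUl.
have -> : u :&: w :&: (v :&: w) = u :&: v :&: w by rewrite setIACA setIid.
have := sub _ _ (subsetT (u :|: v :|: w)); rewrite cardsT card_ord.
have := sub _ _ (subsetIl (u :&: v) w).
have : (#|u :&: v :&: w| <= #|u :&: w|)%N by rewrite sub // setIAC subsetIl.
have : (#|u :&: v :&: w| <= #|v :&: w|)%N by rewrite sub // -setIA subsetIr.
have incl (x y z : {set 'I_23}) : (#|x :&: y| + #|x :&: z| <= #|x| + #|x :&: y :&: z|)%N.
  by rewrite -cardsUI -setIUr setIACA setIid setIA leq_add ?sub ?subsetIl.
have := incl u v w; have := incl v u w; rewrite [v :&: u]setIC.
have := incl w u v; rewrite -[w :&: u :&: v]setIA ![w :&: _]setIC.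
rewrite cu cv cw /realizable; clear.
by move: #|_| #|_| #|_| #|_| => s t j i *; do ![apply/andP; split]; lia.
Qed.

Theorem intersections_357 C :
    (forall u, u \in C -> #|u| = 11%N) ->
    (forall u v, u \in C -> v \in C -> u != v -> #|u :&: v| <= 7)%N ->
    #|C| = 1288%N ->
  forall u v, u \in C -> v \in C -> u != v -> #|u :&: v| \in [:: 3; 5; 7]%N.
Proof.
move=> c11 le7 cC.
pose K u v w := kernel_value #|u :&: v| #|u :&: w| #|v :&: w| #|u :&: v :&: w|.
pose m u v := entry multiplier #|u :&: v|.
pose b u v := pair_bound #|u :&: v|.
have [N sumC NE] : exists2 N : Z, (forall F : Z, \sum_(w in C) F = N * F) & N = Zpos 1288.
  exists #|C|%:R; first by move=> F; rewrite sumr_const mulr_natl.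
  by rewrite -(natn #|C|) -(rmorph_nat Z.of_nat) natn cC.
pose sum2 (F : {set 'I_23} -> {set 'I_23} -> Z) := \sum_(u in C) \sum_(v in C) F u v.
pose sum3 (F : {set 'I_23} -> {set 'I_23} -> {set 'I_23} -> Z) :=
  \sum_(u in C) sum2 (F u).
have sum2D F G : sum2 (fun u v => F u v + G u v) = sum2 F + sum2 G.
  by rewrite /sum2 -big_split; apply: eq_bigr => u _; rewrite big_split.
have sum3D F G : sum3 (fun u v w => F u v w + G u v w) = sum3 F + sum3 G.
  by rewrite /sum3 -big_split; apply: eq_bigr => u _; rewrite sum2D.
have sum3_12 F : sum3 (fun u v w => F v u w) = sum3 F by apply: exchange_big.
have sum3_23 F : sum3 (fun u v w => F u w v) = sum3 F.
  by apply: eq_bigr => u _; apply: exchange_big.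
have sum3_1 F : sum3 (fun u v w => F u v) = N * sum2 F.
  rewrite mulr_sumr; apply: eq_bigr => u _; rewrite mulr_sumr.
  by apply: eq_bigr => v _; apply: sumC.
pose t u v w := triple_value #|u :&: v| #|u :&: w| #|v :&: w| #|u :&: v :&: w|.
have K0 : 0 <= sum3 K.
  by apply: sumr_ge0 => u uC; apply: kernel_value_ge0; rewrite ?c11.
(* Summed over all triples, the three roles of the kernel give equal totals, and each multiplier
   term leaves one word free. *)
have sumt : sum3 t = 3 * sum3 K + 3 * (N * sum2 m).
  transitivity (sum3 (fun u v w => K u v w + K v u w + K w u v + m u v + m u w + m v w)).
    apply: eq_bigr => u _; apply: eq_bigr => v _; apply: eq_bigr => w _.
    rewrite /t /triple_value /K /m.
    by rewrite [v :&: u]setIC [w :&: u]setIC [w :&: v]setIC [u :&: w :&: v]setIAC.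
  rewrite (_ : sum3 _ = sum3 K + sum3 (fun u v w => K v u w) + sum3 (fun u v w => K w u v)
    + sum3 (fun u v w => m u v) + sum3 (fun u v w => m u w) + sum3 (fun u v w => m v w));
    last by rewrite -!sum3D.
  have m1 := sum3_1 m.
  have m2 := etrans (sum3_23 (fun u v _ => m u v)) m1.
  rewrite (sum3_12 K) (sum3_12 (fun u _ w => m u w)) [sum3 (fun u v w => m u w)]m2 m1.
  rewrite (etrans (sum3_23 (fun u v w => K v u w)) (sum3_12 K)).
  by ring.
have diag (F : {set 'I_23} -> Z) u : u \in C ->
    \sum_(v in C) (if u == v then F v else 0) = F u.
  move=> uC; rewrite (bigD1 u) //= eqxx big1 ?addr0 // => v /andP[_ /negbTE].
  by rewrite eq_sym => ->.
have le3 : sum3 t <= 3 * sum2 b.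
  rewrite (_ : 3 * sum2 b = sum3 (fun u v w => pair_boundif (v == w) #|u :&: v|)
      + sum3 (fun u v w => pair_boundif (u == w) #|u :&: v|)
      + sum3 (fun u v w => pair_boundif (u == v) #|u :&: w|)).
    rewrite -!sum3D; apply: ler_sum => u uC; apply: ler_sum => v vC.
    by apply: ler_sum => w wC; apply: triple_value_le; do ?[exact: c11 | exact: le7].
  have -> : sum3 (fun u v w => pair_boundif (v == w) #|u :&: v|) = sum2 b.
    by apply: eq_bigr => u uC; apply: eq_bigr => v vC; apply: (diag (fun=> b u v)).
  have -> : sum3 (fun u v w => pair_boundif (u == w) #|u :&: v|) = sum2 b.
    by apply: eq_bigr => u uC; apply: eq_bigr => v vC; apply: (diag (fun=> b u v)).
  have -> : sum3 (fun u v w => pair_boundif (u == v) #|u :&: w|) = sum2 b.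
    rewrite (sum3_23 (fun u v w => pair_boundif (u == w) #|u :&: v|)).
    by apply: eq_bigr => u uC; apply: eq_bigr => v vC; apply: (diag (fun=> b u v)).
  by ring.
pose q u v := pair_excess #|u :&: v|.
(* Comparing the value of [sum3 t] with its upper bound and dropping the nonnegative [sum3 K] leaves
   an inequality between sums over pairs. *)
have q0 : 0 <= sum2 q.
  have -> : sum2 q = sum2 b - N * sum2 m.
    rewrite mulr_sumr -sumrB; apply: eq_bigr => u _.
    by rewrite mulr_sumr -sumrB; apply: eq_bigr => v _; rewrite NE.
  have : 3 * sum3 K + 3 * (N * sum2 m) <= 3 * sum2 b by rewrite -sumt.
  by rewrite -mulrDr ler_pM2l // subr_ge0; apply: le_trans; rewrite lerDr.
move=> u0 v0 u0C v0C ne0; apply/negPn/negP => bad.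
have /andP[/allP good /allP badq] := pair_checkT.
have bad_size u v : u \in C -> v \in C -> u != v -> #|u :&: v| \notin [:: 3; 5; 7]%N ->
   #|u :&: v| \in [:: 0; 1; 2; 4; 6]%N.
  by move=> uC vC /(le7 _ _ uC vC); case: #|_| => [|[|[|[|[|[|[|[|]]]]]]]].
have qle u v : u \in C -> v \in C -> u != v -> q u v <= 0.
  move=> uC vC uv; have [/good//|] := boolP (#|u :&: v| \in [:: 3; 5; 7]%N).
  by move=> /(bad_size _ _ uC vC uv)/badq/andP[].
have /badq/andP[_ q0lt] := bad_size _ _ u0C v0C ne0 bad.
pose d u v : Z := if u == v then pair_excess 11 else 0.
pose e u v : Z := if u0 == u then if v0 == v then q u0 v0 else 0 else 0.
(* All off-diagonal excesses are at most 0, so only the diagonal and the bad pair are kept; the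
   check makes this bound negative. *)
have : sum2 q <= N * pair_excess 11 + q u0 v0.
  have -> : N * pair_excess 11 = sum2 d.
    by rewrite -sumC; apply: eq_bigr => u uC; rewrite (diag (fun=> pair_excess 11)).
  have -> : q u0 v0 = sum2 e.
    rewrite /sum2 (bigD1 u0) //= [X in _ + X]big1 ?addr0; last first.
      by move=> u /andP[_ ne]; rewrite /e eq_sym (negbTE ne) big1.
    by rewrite /e eqxx (diag (fun=> q u0 v0)).
  rewrite -sum2D; apply: ler_sum => u uC; apply: ler_sum => v vC.
  rewrite /d /e; have [<-|uv] := eqVneq u v.
    rewrite /q setIid (c11 u uC); have [<-|_] := eqVneq u0 u; last by rewrite addr0.
    by rewrite [v0 == u0]eq_sym (negbTE ne0) addr0.
  rewrite add0r; have [->|_] := eqVneq u0 u; last exact: qle.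
  by have [->|_] := eqVneq v0 v; [|exact: qle].
by rewrite NE leNgt (lt_le_trans _ q0).
Qed.

End Triples.

(** * Words and binary linear codes *)

Section Words.

Variable n : nat.
Implicit Types (u v w x y : word n) (E : code n) (S : {set 'I_n}).

Definition supp u : {set 'I_n} := [set i | u 0 i != 0].

Definition word_of S : word n := \row_i (i \in S)%:R.

Definition linear_code E := 0 \in E /\ {in E &, forall u v, u + v \in E}.

Definition dot u v : bool := odd #|supp u :&: supp v|.

Lemma F2_eqP (a b : 'F_2) : (a != 0) = (b != 0) -> a = b.
Proof. by case: a b => [[|[|//]] ?] [[|[|//]] ?] //= _; apply: val_inj. Qed.

Lemma F2_cases (a : 'F_2) : a = 0 \/ a = 1.
Proof. by case: a => [[|[|//]] ?]; [left | right]; apply: val_inj. Qed.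

Lemma F2_addb (a b : 'F_2) : (a + b != 0) = (a != 0) (+) (b != 0).
Proof. by case: a b => [[|[|//]] ?] [[|[|//]] ?]. Qed.

Lemma in_supp u i : (i \in supp u) = (u 0 i != 0). Proof. by rewrite inE. Qed.

Lemma supp_inj : injective supp.
Proof.
move=> u v /setP uv; apply/rowP=> i; apply: F2_eqP.
by rewrite -!in_supp uv.
Qed.

Lemma supp_word_of S : supp (word_of S) = S.
Proof. by apply/setP=> i; rewrite in_supp mxE; case: (i \in S). Qed.

Lemma in_suppD u v i : (i \in supp (u + v)) = (i \in supp u) (+) (i \in supp v).
Proof. by rewrite !in_supp mxE F2_addb. Qed.

Lemma supp0 : supp 0 = set0.
Proof. by apply/setP=> i; rewrite in_supp mxE eqxx inE. Qed.

Lemma word_addrr u : u + u = 0.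
Proof. by apply: supp_inj; apply/setP=> i; rewrite in_suppD addbb supp0 inE. Qed.

Lemma word_addKr u : involutive (+%R u).
Proof. by move=> v; rewrite addrA word_addrr add0r. Qed.

Lemma word_addrK u : involutive (+%R^~ u).
Proof. by move=> v; rewrite /= -addrA word_addrr addr0. Qed.

Lemma hammingE u v : hamming u v = weight (u + v).
Proof.
congr #|pred_of_set _|; apply/setP=> i; rewrite !inE mxE F2_addb.
by case: (u 0 i) (v 0 i) => [[|[|//]] ?] [[|[|//]] ?].
Qed.

Lemma weightE u : weight u = #|supp u|. Proof. by []. Qed.

Lemma weight_eq0 u : (weight u == 0)%N = (u == 0).
Proof. by rewrite weightE cards_eq0 -supp0 (inj_eq supp_inj). Qed.

Lemma suppD u v : supp (u + v) = (supp u :\: supp v) :|: (supp v :\: supp u).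
Proof.
apply/setP=> i; rewrite in_suppD in_setU !in_setD.
by case: (i \in supp u); case: (i \in supp v).
Qed.

Lemma weightD u v :
  (weight (u + v) + 2 * #|supp u :&: supp v| = weight u + weight v)%N.
Proof.
rewrite !weightE suppD -(cardsID (supp v) (supp u)) -(cardsID (supp u) (supp v)).
rewrite [supp v :&: _]setIC cardsU (_ : _ :&: _ = set0) ?cards0; first by lia.
by apply/setP=> i; rewrite !inE; do !case: eqP.
Qed.

Lemma dotC u v : dot u v = dot v u. Proof. by rewrite /dot setIC. Qed.

Lemma odd_weightD u v : odd (weight (u + v)) = odd (weight u) (+) odd (weight v).
Proof. by rewrite -!oddD -(weightD u v) oddD oddM addbF. Qed.

Lemma dotDl u v w : dot (u + v) w = dot u w (+) dot v w.
Proof.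
have cap x : #|supp x :&: supp w| = weight (word_of (supp x :&: supp w)).
  by rewrite weightE supp_word_of.
rewrite /dot !cap -odd_weightD; congr (odd (weight _)).
by apply: supp_inj; apply/setP=> i; rewrite in_suppD !supp_word_of !in_setI in_suppD;
  do !case: (i \in _).
Qed.

Lemma dotDr u v w : dot u (v + w) = dot u v (+) dot u w.
Proof. by rewrite dotC dotDl !(dotC u). Qed.

Lemma dot0l u : dot 0 u = false. Proof. by rewrite /dot supp0 set0I cards0. Qed.

Lemma dot_set1 u i : dot u (word_of [set i]) = (i \in supp u).
Proof.
rewrite /dot supp_word_of; have [iu|iu] := boolP (i \in supp u).
  by rewrite (setIidPr _) ?cards1 // sub1set.
rewrite (_ : _ :&: _ = set0) ?cards0 //; apply/setP=> j.
by rewrite in_setI in_set1 in_set0; case: (j =P i) => [->|_]; rewrite ?andbF ?(negbTE iu).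
Qed.

(** If some [d] in [E] is not orthogonal to [y], translation by [d] permutes [E] and negates the
    sum. *)
Lemma linear_char_sum E y : linear_code E ->
  \sum_(c in E) (-1) ^+ dot c y = (if [forall (c | c \in E), ~~ dot c y] then #|E|%:R else 0) :> int.
Proof.
move=> [_ linE]; case: ifPn => [/forall_inP orth|].
  rewrite -sum1_card natr_sum; apply: eq_bigr => c /orth/negbTE-> //.
rewrite negb_forall_in => /exists_inP[d Ed /negPn dy].
set s := \sum_(c in E) _; have : s = - s.
  rewrite {1}/s (reindex_inj (addIr d)) /= -sumrN.
  apply: eq_big => [c|c _]; last by rewrite dotDl dy addbT signrN.
  by apply/idP/idP => [cd|/linE->//]; rewrite -(word_addrK d c) linE.
by lia.
Qed.

Definition dual_code E : code n := [set y | [forall (c | c \in E), ~~ dot c y]].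

Lemma dual_codeP E y : reflect {in E, forall c, dot c y = false} (y \in dual_code E).
Proof.
rewrite inE; apply: (iffP forall_inP) => orth c /orth; first by move/negbTE.
by move=> ->.
Qed.

Lemma linear_setT : linear_code [set: word n].
Proof. by split=> [|u v _ _]; rewrite inE. Qed.

Lemma card_words : #|[set: word n]| = (2 ^ n)%N.
Proof. by rewrite cardsT card_mx card_Fp // mul1n. Qed.

(** The character sum over all pairs of a codeword and a word is evaluated in both orders: summing
    over codewords first selects the dual code, summing over words first selects the codeword 0. *)
Lemma card_dual E : linear_code E -> (#|E| * #|dual_code E| = 2 ^ n)%N.
Proof.
move=> linE; have [E0 _] := linE; apply/eqP; rewrite -(eqr_nat int) natrM; apply/eqP.
transitivity (\sum_(y in [set: word n]) \sum_(c in E) (-1) ^+ dot c y : int).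
  under eq_bigr do rewrite linear_char_sum //.
  rewrite -big_mkcondr /= sumr_const mulr_natr; congr (_ *+ _).
  by apply: eq_card => y; rewrite inE unfold_in /= in_setT.
rewrite exchange_big (bigD1 0) //= [X in _ + X]big1 ?addr0.
  by under eq_bigr do rewrite dot0l; rewrite sumr_const card_words.
move=> c /andP[_ c0]; under eq_bigr do rewrite dotC.
rewrite linear_char_sum; last exact: linear_setT.
rewrite ifN // negb_forall_in; have : supp c != set0 by rewrite -supp0 (inj_eq supp_inj).
case/set0Pn=> i ic; apply/exists_inP.
by exists (word_of [set i]); rewrite ?inE // negbK dotC dot_set1.
Qed.

Definition agree S u v := [forall (i | i \in S), (i \in supp u) == (i \in supp v)].

(** Characters are summed over codewords c and words y supported in [S]. The sum over y selects the
    c that agree with [w] on [S]; the sum over c selects the y in the dual code, which lies in [E],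
    hence only y = 0. So every pattern on [S] is taken equally often. *)
Lemma card_fibre E S w : linear_code E -> dual_code E \subset E ->
    (forall c, c \in E -> supp c \subset S -> c = 0) ->
  (#|[set c in E | agree S c w]| * 2 ^ #|S| = #|E|)%N.
Proof.
move=> linE subE free; pose ES : code n := [set y | supp y \subset S].
have linES : linear_code ES.
  split=> [|u v]; rewrite !inE ?supp0 ?sub0set // => uS vS.
  by rewrite suppD subUset !(subset_trans (subsetDl _ _)).
have cES : #|ES| = (2 ^ #|S|)%N.
  rewrite -card_powerset -(card_imset _ supp_inj); apply: eq_card => A.
  rewrite powersetE; apply/imsetP/idP => [[y]|AS]; first by rewrite inE => yS ->.
  by exists (word_of A); rewrite ?inE supp_word_of.
apply/eqP; rewrite -(eqr_nat int) natrM; apply/eqP.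
transitivity (\sum_(c in E) \sum_(y in ES) (-1) ^+ dot y (c + w) : int).
  under eq_bigr do rewrite linear_char_sum //.
  rewrite -big_mkcondr /= sumr_const cES mulr_natl; congr (_ *+ _).
  apply: eq_card => c; rewrite inE [RHS]unfold_in; case: (c \in E) => //=.
  apply/forall_inP/forall_inP => [ag y|ort i iS].
    rewrite inE => /subsetP yS; rewrite /dot (_ : _ :&: _ = set0) ?cards0 //.
    apply/setP=> i; rewrite !inE mxE F2_addb -!in_supp.
    by apply/andP=> -[/yS/ag/eqP->]; rewrite addbb.
  have := ort (word_of [set i]); rewrite inE supp_word_of sub1set => /(_ iS).
  by rewrite dotC dot_set1 in_suppD; case: (_ \in _); case: (_ \in _).
under eq_bigr do under eq_bigr do rewrite dotDr signr_addb mulrC.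
rewrite exchange_big /= (bigD1 0) /=; last by have [] := linES.
rewrite [X in _ + X]big1 ?addr0.
  by under eq_bigr do rewrite !dot0l mulr1; rewrite sumr_const.
move=> y /andP[yS y0]; rewrite -mulr_sumr.
under eq_bigr do rewrite dotC; rewrite linear_char_sum // ifN ?mulr0 //.
apply: contra y0 => /forall_inP orth; apply/eqP/free; last by move: yS; rewrite inE.
by apply: (subsetP subE); rewrite inE; apply/forall_inP.
Qed.

Lemma fibre_exists E S w : linear_code E -> dual_code E \subset E ->
    (forall c, c \in E -> supp c \subset S -> c = 0) ->
  exists2 c, c \in E & {in S, forall i, (i \in supp c) = (i \in supp w)}.
Proof.
move=> linE subE free; have := card_fibre w linE subE free.
have [E0 _] := linE; have : (0 < #|E|)%N by apply/card_gt0P; exists 0.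
move=> Epos cE; move: Epos; rewrite -cE muln_gt0 => /andP[/card_gt0P[c]].
rewrite inE => /andP[cE' /forall_inP ag] _; exists c => // i /ag/eqP //.
Qed.

Lemma span_ind (X : seq (word n)) (Q : word n -> Prop) :
  Q 0 -> (forall u v, Q u -> Q v -> Q (u + v)) -> {in X, forall u, Q u} ->
  forall v, v \in <<X>>%VS -> Q v.
Proof.
move=> Q0 QD QX; elim: X QX => [|x X IHX] QX v.
  by rewrite span_nil memv0 => /eqP->.
rewrite span_cons => /memv_addP[_ /vlineP[k ->]] [w wX ->].
have Qw : Q w by apply: IHX wX => u uX; apply: QX; rewrite inE uX orbT.
case: (F2_cases k) => ->; first by rewrite scale0r add0r.
by rewrite scale1r; apply: QD => //; apply: QX; apply: mem_head.
Qed.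

Lemma linear_code_of (V : {vspace word n}) : linear_code (code_of V).
Proof. by split=> [|u v]; rewrite !inE ?mem0v //; apply: memvD. Qed.

Lemma card_code_of (V : {vspace word n}) : #|code_of V| = (2 ^ \dim V)%N.
Proof. by rewrite cardsE card_vspace card_Fp. Qed.

End Words.

(** * The code spanned by the extended words *)

(** Extended Golay codes are handled in this form: the dimension is given by the cardinality, and
    doubly evenness, the source of self-duality, is included. *)
Definition golay_like (E : code 24) :=
  [/\ linear_code E, #|E| = (2 ^ 12)%N, {in E, forall x, (4 %| weight x)%N}
    & {in E, forall x, x != 0 -> (8 <= weight x)%N}].

(** In [weightD] all three weights are divisible by 4, so the intersection size is even. *)
Lemma doubly_even_orthogonal n (E : code n) : linear_code E ->
  {in E, forall x, (4 %| weight x)%N} -> {in E &, forall x y, dot x y = false}.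
Proof.
move=> [_ linE] dblE x y Ex Ey; have := weightD x y; rewrite /dot.
have := dblE _ Ex; have := dblE _ Ey; have := dblE _ (linE _ _ Ex Ey).
by case/dvdnP=> a -> /dvdnP[b ->] /dvdnP[c ->]; lia.
Qed.

Lemma self_dual n m (E : code n) : n = (m + m)%N -> linear_code E -> #|E| = (2 ^ m)%N ->
  {in E &, forall x y, dot x y = false} -> dual_code E = E.
Proof.
move=> nE linE cE orth; apply/esym/eqP; rewrite eqEcard.
have : (2 ^ m * #|dual_code E| = 2 ^ m * 2 ^ m)%N by rewrite -expnD -{1}cE card_dual // nE.
move/eqP; rewrite eqn_pmul2l ?expn_gt0 // cE => /eqP->; rewrite leqnn andbT.
apply/subsetP=> y yE; apply/dual_codeP => c cE'.
exact: orth.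
Qed.

Definition ones n : word n := word_of [set: 'I_n].

Lemma supp_ones n i : i \in supp (ones n). Proof. by rewrite supp_word_of inE. Qed.

Lemma ones_in_dual n (E : code n) : {in E, forall x, ~~ odd (weight x)} -> ones n \in dual_code E.
Proof.
move=> evenE; apply/dual_codeP=> c /evenE/negbTE.
by rewrite /dot supp_word_of setIT.
Qed.

Section Extension.

Implicit Types (u v : word 23) (C : code 23).

(** The bit added at [ord_max] is constantly 1, which is the parity bit for words of weight 11. *)
Definition extend u : word 24 :=
  \row_i (if unlift ord_max i is Some j then u 0 j else 1).

Lemma in_supp_extend u (i : 'I_24) :
  (i \in supp (extend u)) = if unlift ord_max i is Some j then j \in supp u else true.
Proof. by rewrite in_supp mxE; case: unlift => // j; rewrite in_supp. Qed.

Lemma ord_max_extend u : ord_max \in supp (extend u).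
Proof. by rewrite in_supp_extend unlift_none. Qed.

Lemma col'_extend u : col' ord_max (extend u) = u.
Proof. by apply/rowP=> i; rewrite !mxE liftK. Qed.

Lemma extend_inj : injective extend.
Proof. by apply: can_inj col'_extend. Qed.

Lemma extend_setI u v :
  supp (extend u) :&: supp (extend v) = ord_max |: [set lift ord_max i | i in supp u :&: supp v].
Proof.
apply/setP=> i; rewrite in_setI !in_supp_extend in_setU1.
case: unliftP => [j ->|->]; last by rewrite eqxx.
rewrite mem_imset ?in_setI; last exact: lift_inj.
by rewrite eq_sym (negbTE (neq_lift _ _)).
Qed.

Lemma card_extend_setI u v :
  #|supp (extend u) :&: supp (extend v)| = #|supp u :&: supp v|.+1.
Proof.
rewrite extend_setI cardsU1 card_imset; last exact: lift_inj.
by case: imsetP => // -[j _ /eqP]; rewrite (negbTE (neq_lift _ _)).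
Qed.

Lemma weight_extend u : weight (extend u) = (weight u).+1.
Proof. by rewrite !weightE -[supp (extend u)]setIid card_extend_setI setIid. Qed.

Lemma weight_extendD u v : weight (extend u + extend v) = hamming u v.
Proof.
have := weightD (extend u) (extend v); rewrite hammingE card_extend_setI !weight_extend.
by have := weightD u v; lia.
Qed.

Variable C : code 23.
Hypothesis cwC : constant_weight_code 8 11 C.
Hypothesis cardC : #|C| = 1288%N.

Lemma weightC u : u \in C -> weight u = 11%N. Proof. by case: cwC => h _ /h. Qed.

Lemma capC u v : u \in C -> v \in C -> u != v -> #|supp u :&: supp v| \in [:: 3; 5; 7]%N.
Proof.
move=> uC vC uv; apply: (@intersections_357 [set supp w | w in C]).
- by move=> _ /imsetP[w wC ->]; apply: weightC.
- move=> _ _ /imsetP[w wC ->] /imsetP[z zC ->]; rewrite (inj_eq (@supp_inj 23)) => wz.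
  case: cwC => _ /(_ _ _ wC zC wz); rewrite hammingE.
  by have := weightD w z; rewrite (weightC wC) (weightC zC); lia.
- by rewrite card_imset //; apply: supp_inj.
- exact: imset_f.
- exact: imset_f.
by rewrite (inj_eq (@supp_inj 23)).
Qed.

Let D : code 24 := [set extend u | u in C].
Let E : code 24 := code_of <<enum D>>%VS.

Let cardD : #|D| = 1288%N.
Proof. by rewrite card_imset //; apply: extend_inj. Qed.

Let subDE : D \subset E.
Proof. by apply/subsetP=> x xD; rewrite inE memv_span // mem_enum. Qed.

Let linE : linear_code E. Proof. exact: linear_code_of. Qed.

Let addE : {in E &, forall x y, x + y \in E}. Proof. by case: linE. Qed.

(** The added point turns the intersection sizes 3, 5, 7 into 4, 6, 8, and the weight 11 into 12. *)
Let dotD : {in D &, forall x y, dot x y = false}.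
Proof.
move=> _ _ /imsetP[u uC ->] /imsetP[v vC ->]; rewrite /dot card_extend_setI.
have [<-|uv] := eqVneq u v; first by rewrite setIid -weightE weightC.
by have := capC uC vC uv; rewrite !inE => /or3P[] /eqP->.
Qed.

Let orthE : {in E &, forall x y, dot x y = false}.
Proof.
have step x : x \in E -> {in D, forall y, dot x y = false}.
  rewrite inE; move: x; apply: span_ind => [y _|u v qu qv y yD|x]; last rewrite mem_enum => xD y yD.
  - exact: dot0l.
  - by rewrite dotDl qu ?qv.
  - exact: dotD.
move=> x y xE; rewrite inE; move: y; apply: span_ind => [|u v qu qv|y]; last rewrite mem_enum => yD.
- by rewrite dotC dot0l.
- by rewrite dotDr qu qv.
- exact: step.
Qed.

Let dblE : {in E, forall x, (4 %| weight x)%N}.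
Proof.
suff H x : x \in <<enum D>>%VS -> x \in E /\ (4 %| weight x)%N.
  by move=> x; rewrite inE => /H[].
move: x; apply: span_ind => [|u v [uE wu] [vE wv]|x]; last rewrite mem_enum => xD.
- by have [E0 _] := linE; split; rewrite // weightE supp0 cards0.
- split; first exact: addE.
  have := orthE uE vE; rewrite /dot; have := weightD u v; lia.
- split; first exact: (subsetP subDE).
  by case/imsetP: xD => u uC ->; rewrite weight_extend weightC.
Qed.

(** Words of [D] contain the last point and words of [d + D] do not, so [E] has at least 2576 > 2^11
    elements; self-orthogonality bounds the dimension by 12. *)
Let cardE : #|E| = (2 ^ 12)%N.
Proof.
have /card_gt0P[d dD] : (0 < #|D|)%N by rewrite cardD.
have dE := subsetP subDE d dD.
pose F : code 24 := [set d + x | x in D].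
have cF : #|F| = 1288%N by rewrite card_imset //; apply: addrI.
have maxD x : x \in D -> ord_max \in supp x by case/imsetP=> u _ ->; apply: ord_max_extend.
have dFD : [disjoint D & F].
  rewrite -setI_eq0; apply/eqP/setP=> x; rewrite in_setI in_set0; apply/negbTE/andP=> -[/maxD].
  by move=> xmax /imsetP[y /maxD ym xE]; move: xmax; rewrite xE in_suppD ym maxD.
have le : (2576 <= #|E|)%N.
  rewrite (_ : 2576%N = #|D :|: F|).
    apply/subset_leq_card; rewrite subUset subDE; apply/subsetP=> _ /imsetP[x xD ->].
    by rewrite addE // (subsetP subDE).
  by rewrite cardsU (disjoint_setI0 dFD) cards0 cardD cF.
have := card_code_of <<enum D>>%VS; rewrite -/E; set m := \dim _ => cE.
have sub : E \subset dual_code E by apply/subsetP=> x xE; apply/dual_codeP=> c cE'; apply: orthE.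
have := card_dual linE; have := subset_leq_card sub.
rewrite cE => le1 eq2; congr (2 ^ _)%N; apply/eqP; rewrite eqn_leq; apply/andP; split.
  rewrite leqNgt; apply/negP => lt; have : (2 ^ m * 2 ^ m <= 2 ^ 24)%N.
    by rewrite -eq2 leq_mul2l le1 orbT.
  by rewrite -expnD leq_exp2l //; lia.
rewrite leqNgt; apply/negP => lt; have : (2 ^ m <= 2 ^ 11)%N by rewrite leq_exp2l.
by move: le; rewrite cE => le /(leq_trans le).
Qed.

Let dualE : dual_code E = E.
Proof. exact: (@self_dual 24 12). Qed.

Let onesE : ones 24 \in E.
Proof. by rewrite -dualE ones_in_dual // => x /dblE; lia. Qed.

Let E1 : code 24 := [set x in E | ord_max \in supp x].

Let in_E1 x : (x \in E1) = (x \in E) && (ord_max \in supp x).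
Proof. by rewrite in_set. Qed.

Let subDE1 : D \subset E1.
Proof.
apply/subsetP=> x xD; rewrite inE (subsetP subDE) //=.
by case/imsetP: xD => u _ ->; apply: ord_max_extend.
Qed.

Let small_free (S : {set 'I_24}) : (#|S| < 4)%N -> forall c, c \in E -> supp c \subset S -> c = 0.
Proof.
move=> ltS c cE /subset_leq_card le; apply/eqP; rewrite -weight_eq0 weightE.
by have := dblE cE; rewrite weightE; move: le ltS; lia.
Qed.

Let cardE1 : #|E1| = (2 ^ 11)%N.
Proof.
have := card_fibre (ones 24) linE _ (small_free _) => /(_ [set ord_max]).
rewrite dualE cards1 cardE => /(_ (subxx _) isT) /eqP; rewrite (expnSr 2 11) eqn_pmul2r // => /eqP <-.
apply: eq_card => x; rewrite !inE; congr (_ && _).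
apply/idP/forall_inP => [xm i /set1P->|/(_ _ (set11 _))/eqP]; rewrite supp_ones in_supp.
  by rewrite xm.
by move=> ->.
Qed.

(* If x has weight 4 and avoids the last point, then C contains at most one of c
   and c + x. If x contains the last point, then a word c of C with |c & x| = 2
   excludes 1 + c + x, which is at distance 20, whereas at most 2^9 words contain x. *)
Let no_weight4 x : x \in E -> weight x != 4%N.
Proof.
move=> xE; apply/negP=> /eqP wx.
(* Intersections 7, 5, 3 in [C] give distances 8, 12, 16; the contradictions below come from the
   distances 4 and 20. *)
have far y z : y \in D -> z \in D -> weight (y + z) \in [:: 0; 8; 12; 16]%N.
  case/imsetP=> u uC -> /imsetP[v vC ->]; rewrite weight_extendD hammingE.
  have [->|uv] := eqVneq u v; first by rewrite word_addrr weightE supp0 cards0.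
  have := weightD u v; rewrite (weightC uC) (weightC vC); have := capC uC vC uv.
  rewrite !inE => /or3P[] /eqP-> eq_w.
  - by rewrite (_ : weight _ = 16%N) //; clear -eq_w; lia.
  - by rewrite (_ : weight _ = 12%N) //; clear -eq_w; lia.
  - by rewrite (_ : weight _ = 8%N) //; clear -eq_w; lia.
have [xmax|xmax] := boolP (ord_max \in supp x); last first.
  pose F := [set x + y | y in D].
  have : (#|D :|: F| <= 2 ^ 11)%N.
    rewrite -cardE1 subset_leq_card // subUset subDE1; apply/subsetP=> _ /imsetP[y yD ->].
    have := subsetP subDE1 y yD; rewrite !in_E1 => /andP[yE ym].
    by rewrite addE // in_suppD ym (negbTE xmax).
  rewrite cardsU (_ : D :&: F = set0) ?cards0.
    by rewrite [#|F|]card_imset ?cardD; last exact: addrI.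
  apply/setP=> y; rewrite in_setI in_set0; apply/negbTE/andP=> -[yD /imsetP[z zD yz]].
  by have := far _ _ yD zD; rewrite yz word_addrK wx.
have /card_gt0P[a] : (0 < #|supp x :\ ord_max|)%N.
  by have := cardsD1 ord_max (supp x); rewrite xmax -weightE wx; case: #|_ :\ _|.
case/setD1P => amax ax; pose S := supp x :\ a.
have cS : #|S| = 3%N by have := cardsD1 a (supp x); rewrite ax -weightE wx; case.
pose P0 : code 24 := [set c in E | supp x \subset supp c].
have in_P0 c : (c \in P0) = (c \in E) && (supp x \subset supp c) by rewrite in_set.
have even_cap c : c \in E -> ~~ odd #|supp c :&: supp x|.
  by move=> cE; have := orthE cE xE; rewrite /dot => ->.
(* Three points of [x] can be prescribed freely, which leaves 2^12 / 2^3 words; orthogonality to [x]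
   then forces the fourth point. *)
have cP0 : #|P0| = (2 ^ 9)%N.
  have := card_fibre (ones 24) linE _ (small_free _) => /(_ S).
  rewrite dualE cS cardE => /(_ (subxx _) isT) /eqP.
  rewrite (expnD 2 9 3) eqn_pmul2r // => /eqP <-.
  apply: eq_card => c; rewrite !in_set; apply: andb_id2l => cE.
  apply/idP/forall_inP => [/subsetP xc i /setD1P[_ /xc ->]|ag]; first by rewrite supp_ones.
  have Sc : S \subset supp c by apply/subsetP=> i /ag; rewrite supp_ones => /eqP.
  apply: contraT => nsub; have ac : a \notin supp c.
    by apply: contra nsub => ac; rewrite -(setD1K ax) subUset sub1set ac.
  have := even_cap c; rewrite inE => /(_ cE); rewrite (_ : _ :&: _ = S) ?cS //.
  apply/setP=> i; rewrite in_setI in_setD1; have [->|ia] := eqVneq i a; first by rewrite (negbTE ac).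
  by apply: andb_idl => ix; apply: (subsetP Sc); rewrite in_setD1 ia.
pose D1 := D :\: P0; pose F := [set c + (ones 24 + x) | c in D1].
have wox : weight (ones 24 + x) = 20%N.
  have w1 : weight (ones 24) = 24%N by rewrite weightE supp_word_of cardsT card_ord.
  have := weightD (ones 24) x; rewrite supp_word_of setTI -weightE wx w1.
  by move: (weight _) => k; clear; lia.
have dDF : D :&: F = set0.
  apply/setP=> y; rewrite in_setI in_set0; apply/negbTE/andP=> -[yD /imsetP[z zD1 yz]].
  have zD : z \in D by case/setDP: zD1.
  by have := far _ _ yD zD; rewrite yz [z + _]addrC word_addrK wox.
have FE1 : D1 :|: F \subset E1 :\: P0.
  rewrite subUset setSD //=; apply/subsetP=> _ /imsetP[c /setDP[cD cP] ->].
  have cE := subsetP subDE c cD.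
  have oE : c + (ones 24 + x) \in E by rewrite addE // addE.
  have := subsetP subDE1 c cD; rewrite in_setD !in_E1 => /andP[_ cm].
  rewrite oE !in_suppD supp_ones xmax cm /= andbT.
  move: cP; rewrite !in_P0 cE oE; apply: contra => /subsetP sub; apply/subsetP=> i ix.
  by have := sub i ix; rewrite !in_suppD supp_ones ix addbF.
(* At least 1288 - 512 = 776 words lie in [D1], and as many in [F], but only 2048 - 512 = 1536 <
   1552 places are available. *)
have := subset_leq_card FE1; rewrite cardsU (_ : D1 :&: F = set0); last first.
  by apply/eqP; rewrite -subset0 -dDF setSI // subsetDl.
rewrite cards0 subn0 [#|F|]card_imset; last exact: addIr.
have := cardsID P0 E1; have := cardsID P0 D; rewrite -/D1 cardD cardE1.
have : (#|D :&: P0| <= 2 ^ 9)%N by rewrite -cP0 subset_leq_card // subsetIr.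
rewrite (_ : E1 :&: P0 = P0) ?cP0.
  by move: #|_| #|_| #|_|; clear; lia.
by apply/setIidPr/subsetP=> c; rewrite in_P0 in_E1 => /andP[-> /subsetP->].
Qed.

Theorem extends_to_golay_like :
  exists2 E : code 24, golay_like E & {in C, forall u, extend u \in E}.
Proof.
exists E; last by move=> u uC; apply/(subsetP subDE)/imset_f.
split=> // x xE x0; have := dblE xE; have := no_weight4 xE.
by rewrite -weight_eq0 in x0; move: x0; lia.
Qed.

End Extension.

(** * Weights in a perfect [23,12,7] code *)

(** The parts of [A] inside and outside [B] are chosen independently. *)
Lemma card_draws_cap (T : finType) (B : {set T}) a m : (a <= m)%N ->
  #|[set A : {set T} | (#|A :&: B| == a) && (#|A| == m)]| =
  ('C(#|B|, a) * 'C(#|T| - #|B|, m - a))%N.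
Proof.
move=> le_am; have cB : #|~: B| = (#|T| - #|B|)%N by rewrite -(cardsC B) addKn.
have split12 (A1 A2 : {set T}) : A1 \subset B -> A2 \subset ~: B ->
    (A1 :|: A2) :&: B = A1 /\ (A1 :|: A2) :\: B = A2.
  move=> s1 s2; rewrite setIUl setDUl (setIidPl s1).
  rewrite (_ : A1 :\: B = set0) ?set0U; last by apply/eqP; rewrite setD_eq0.
  have d2 : A2 :&: B = set0 by apply/eqP; rewrite setI_eq0 disjoints_subset.
  by rewrite d2 setU0; split=> //; apply/setDidPl; rewrite -setI_eq0 d2.
rewrite -(cards_draws B) -cB -(cards_draws (~: B)) -cardsX.
rewrite -[RHS](@card_in_imset _ _ (fun p => p.1 :|: p.2)); last first.
  move=> [A1 A2] [B1 B2] /setXP[/setIdP[s1 _] /setIdP[s2 _]] /setXP[/setIdP[t1 _] /setIdP[t2 _]] /= eqU.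
  have [e1 e2] := split12 _ _ s1 s2; have [f1 f2] := split12 _ _ t1 t2.
  by congr pair; [rewrite -e1 eqU f1 | rewrite -e2 eqU f2].
apply: eq_card => A; rewrite inE; apply/andP/imsetP => [[/eqP cAB /eqP cA]|].
  exists (A :&: B, A :\: B); last by rewrite /= setID.
  rewrite in_setX !inE /= subsetIr cAB eqxx setDE subsetIr -setDE /=.
  by have := cardsID B A; rewrite cA cAB => <-; rewrite addKn.
move=> [[A1 A2] /setXP[/setIdP[s1 /eqP c1] /setIdP[s2 /eqP c2]] /= ->].
have [e1 e2] := split12 _ _ s1 s2; rewrite -(cardsID B (A1 :|: A2)) e1 e2 c1 c2.
by rewrite subnKC.
Qed.

Lemma card_weight n k : #|[set x : word n | weight x == k]| = 'C(n, k).
Proof.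
rewrite -[in RHS](card_ord n) -card_draws -(card_imset _ (@supp_inj n)).
apply: eq_card => A; rewrite inE; apply/imsetP/eqP => [[x]|cA].
  by rewrite inE => /eqP wx ->.
by exists (word_of A); rewrite ?inE ?weightE supp_word_of ?cA.
Qed.

(** The words are sorted by the size a of their intersection with [c], which determines the
    distance. Where the subtraction could truncate, a exceeds the weight of [c] and the binomial
    coefficient vanishes. *)
Lemma card_weight_near n (c : word n) m r :
  #|[set x | (weight x == m) && (weight (x + c) <= r)%N]| =
  (\sum_(a < m.+1) (weight c + m - a.*2 <= r) * ('C(weight c, a) * 'C(n - weight c, m - a)))%N.
Proof.
rewrite -sum1_card.
transitivity (\sum_(a < m.+1) \sum_(x : word n |
   (#|supp x :&: supp c| == a) && (weight x == m)) (weight c + m - a.*2 <= r))%N.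
  rewrite (exchange_big_dep (fun x => weight x == m)) /=; last by move=> ? ? _ /andP[].
  rewrite big_mkcond [RHS]big_mkcond /=; apply: eq_bigr => x _; rewrite inE.
  have [wx|] := eqVneq (weight x) m; last by [].
  have lt_m : (#|supp x :&: supp c| < m.+1)%N by rewrite ltnS -wx subset_leq_card ?subsetIl.
  rewrite (bigD1 (Ordinal lt_m)) ?eqxx //= big1 ?addn0.
    have := weightD x c; rewrite wx => wxc.
    rewrite (_ : weight (x + c) = weight c + m - #|supp x :&: supp c|.*2)%N.
      by case: leqP.
    by rewrite addnC -wxc mul2n addnK.
  by move=> a /andP[/andP[/eqP e _]]; rewrite -val_eqE /= e eqxx.
apply: eq_bigr => a _; rewrite sum_nat_const mulnC; congr (_ * _)%N.
rewrite -[in X in 'C(X - _, _)](card_ord n) -card_draws_cap; last by rewrite -ltnS.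
rewrite -(card_imset _ (@supp_inj n)); apply: eq_card => A; rewrite inE.
apply/imsetP/idP => [[x]|cA]; first by rewrite unfold_in => ? ->.
by exists (word_of A); rewrite ?unfold_in /= ?weightE supp_word_of.
Qed.

Section PerfectCode.

Variable P : code 23.
Hypotheses (linP : linear_code P) (cardP : #|P| = (2 ^ 12)%N).
Hypothesis distP : {in P, forall x, x != 0 -> (7 <= weight x)%N}.

Let near_unique x c d : c \in P -> d \in P ->
  (weight (x + c) <= 3)%N -> (weight (x + d) <= 3)%N -> c = d.
Proof.
move=> cP dP wc wd; apply/eqP; rewrite -(inj_eq (addrI d)) word_addrr; apply: contraTT wd.
move=> ne0; have dcP : d + c \in P by case: linP => _; apply.
have := distP dcP ne0; have := weightD (x + d) (x + c).
rewrite (_ : x + d + (x + c) = d + c); last by rewrite addrACA word_addrr add0r.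
by move: wc; lia.
Qed.

(** The sphere sizes are 1 + 23 + 253 + 1771 = 2^11. *)
Let card_ball c : #|[set x : word 23 | (weight (x + c) <= 3)%N]| = (2 ^ 11)%N.
Proof.
transitivity #|[set x : word 23 | (weight x <= 3)%N]|.
  rewrite -[LHS](card_imset _ (addIr c)); apply: eq_card => x; rewrite inE.
  apply/imsetP/idP => [[y]|wx]; first by rewrite inE => ? ->.
  by exists (x + c); rewrite ?inE word_addrK.
rewrite -sum1_card; transitivity (\sum_(k < 4) \sum_(x : word 23 | weight x == k) 1)%N.
  rewrite (exchange_big_dep predT) //= big_mkcond /=; apply: eq_bigr => x _; rewrite inE.
  rewrite !big_mkcond !big_ord_recr big_ord0 /=.
  by case: (weight x) => [|[|[|[|]]]].
under eq_bigr do rewrite sum1dep_card card_weight.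
by rewrite !big_ord_recr big_ord0.
Qed.

(** Balls of radius 3 about codewords are disjoint because nonzero weights are at least 7, and 2^12
    balls of size 2^11 fill the whole space. *)
Lemma perfect_covering x : exists2 c, c \in P & (weight (x + c) <= 3)%N.
Proof.
pose near x : {set word 23} := [set c in P | (weight (x + c) <= 3)%N].
have near1 y : (#|near y| <= 1)%N.
  apply/card_le1_eqP => c d; rewrite !inE => /andP[cP wc] /andP[dP wd].
  exact: (near_unique dP cP wd wc).
have : (\sum_(y : word 23) #|near y| = 2 ^ 23)%N.
  under eq_bigr do rewrite -sum1dep_card big_mkcondr.
  rewrite exchange_big /=; under eq_bigr do rewrite -big_mkcond sum1dep_card card_ball.
  by rewrite sum_nat_const cardP -expnD.
rewrite -card_words cardsT -sum1_card => /eqP.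
have [_ ->] := leqif_sum (fun y (_ : predT y) => leqif_eq (near1 y)).
move=> /forall_inP/(_ x isT)/eqP cx; have /card_gt0P[c] : (0 < #|near x|)%N by rewrite cx.
by rewrite inE => /andP[cP wc]; exists c.
Qed.

Definition near_count w m : nat :=
  sumn [seq (w + m - a.*2 <= 3) * ('C(w, a) * 'C(23 - w, m - a)) | a <- iota 0 m.+1]%N.

Let A w := #|[set c in P | weight c == w]|.

(** Each word of weight [m] lies in exactly one ball; sorting the balls by the weight of their
    centre gives a linear equation for the weight distribution. *)
Let count_eq m : (sumn [seq A w * near_count w m | w <- iota 0 24] = 'C(23, m))%N.
Proof.
rewrite -card_weight -sum1_card.
transitivity
  (\sum_(c in P) \sum_(x : word 23 | (weight x == m) && (weight (x + c) <= 3)%N) 1)%N.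
  transitivity (\sum_(w < 24) \sum_(c in P | weight c == w) near_count w m)%N.
    rewrite sumnE big_map -[iota 0 24]/(index_iota 0 24) big_mkord.
    by apply: eq_bigr => w _; rewrite sum_nat_cond_const.
  rewrite (exchange_big_dep (mem P)) /=; last by move=> ? ? _ /andP[].
  apply: eq_bigr => c cP; have lt24 : (weight c < 24)%N.
    by rewrite ltnS weightE (leq_trans (max_card _)) ?card_ord.
  rewrite (bigD1 (Ordinal lt24)) /= ?cP ?eqxx // big1 ?addn0.
    rewrite sum1dep_card card_weight_near /near_count sumnE big_map.
    by rewrite -[iota 0 m.+1]/(index_iota 0 m.+1) big_mkord.
  by move=> w /andP[/andP[_ /eqP e]]; rewrite -val_eqE /= e eqxx.
rewrite (exchange_big_dep (fun x => weight x == m)) /=; last by move=> ? ? _ /andP[].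
rewrite [RHS](eq_bigl (fun x => weight x == m)); last by move=> x; rewrite inE.
apply: eq_bigr => x wx; have [c cP wc] := perfect_covering x.
rewrite (bigD1 c) /= ?cP ?wx // big1 // => d /andP[/andP[dP /andP[_ wd]] /eqP[]].
exact: (near_unique dP cP wd wc).
Qed.

(** There are no codewords of weight 1 to 6, so the equations for words of weight 4, ..., 8
    determine in turn the numbers of codewords of weight 7, ..., 11, namely 253, 506, 0, 0, 1288. *)
Lemma perfect_weight11 : #|[set c in P | weight c == 11%N]| = 1288%N.
Proof.
have A0 : A 0 = 1%N.
  transitivity #|[set (0 : word 23)]|; last by rewrite cards1.
  apply: eq_card => c.
  rewrite !inE weight_eq0; case: eqP => [->|]; rewrite ?andbF // andbT.
  by case: linP.
have A16 w : (0 < w < 7)%N -> A w = 0%N.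
  move=> /andP[w0 w7]; apply/eqP; rewrite cards_eq0 -subset0; apply/subsetP => c.
  rewrite !inE => /andP[cP /eqP wc]; have : c != 0 by rewrite -weight_eq0 wc -lt0n.
  by move/(distP cP); rewrite wc leqNgt w7.
have peel (f : nat -> nat) : sumn [seq A w * f w | w <- iota 0 24]%N =
    (f 0 + sumn [seq p.1 * p.2 | p <- zip (map A (iota 7 17)) (map f (iota 7 17))])%N.
  by rewrite /= A0 (A16 1%N) // (A16 2) // (A16 3) // (A16 4) // (A16 5) // (A16 6) // mul1n.
have evaluate m := esym (etrans (esym (peel (near_count^~ m))) (count_eq m)).
(* Multiplication by m! turns the binomial coefficient into a falling factorial, which expands to a
   short product. *)
have binE m : ('C(23, m) * m`! = 23 ^_ m)%N by apply: bin_ffact.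
move: (binE 4%N) (binE 5%N) (binE 6%N) (binE 7%N) (binE 8%N); rewrite !evaluate.
(* Entry k of each list belongs to codeword weight 7 + k. Beyond weight m + 3 no word of weight m is
   within distance 3, so the system is triangular. *)
have -> : [seq near_count i 4 | i <- iota 7 17] = 35%N :: nseq 16 0%N by vm_compute.
have -> : [seq near_count i 5 | i <- iota 7 17] = [:: 21; 56]%N ++ nseq 15 0%N by vm_compute.
have -> : [seq near_count i 6 | i <- iota 7 17] = [:: 343; 28; 84]%N ++ nseq 14 0%N.
  by vm_compute.
have -> : [seq near_count i 7 | i <- iota 7 17] = [:: 113; 428; 36; 120]%N ++ nseq 13 0%N.
  by vm_compute.
have -> : [seq near_count i 8 | i <- iota 7 17] =
    [:: 856; 121; 513; 45; 165]%N ++ nseq 12 0%N by vm_compute.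
rewrite -/(A 11) /= !muln0 !addn0 !ffactnS !ffactn0 !factS fact0 /=.
move: (A 7) (A 8) (A 9) (A 10) (A 11) => a7 a8 a9 a10 a11.
rewrite (_ : near_count 0 4 = 0%N) // (_ : near_count 0 5 = 0%N) //.
rewrite (_ : near_count 0 6 = 0%N) // (_ : near_count 0 7 = 0%N) //.
rewrite (_ : near_count 0 8 = 0%N) //.
clear => e4 e5 e6 e7 e8; have a7E : a7 = 253%N by clear -e4; lia.
rewrite a7E in e5 e6 e7 e8; have a8E : a8 = 506%N by clear -e5; lia.
rewrite a8E in e6 e7 e8; have a9E : a9 = 0%N by clear -e6; lia.
rewrite a9E in e7 e8; have a10E : a10 = 0%N by clear -e7; lia.
by rewrite a10E in e8; clear -e8; lia.
Qed.

End PerfectCode.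

(** * Uniqueness of the extended Golay code *)

Section BitLists.

Implicit Types (l m : seq bool) (rows : seq (seq bool)).

Definition xorl l m : seq bool := [seq p.1 (+) p.2 | p <- zip l m].

Definition word_of_bits l : word 24 := \row_i (nth false l i)%:R.

Definition span_list rows k : seq (seq bool) :=
  foldr (fun r s => s ++ [seq xorl r m | m <- s]) [:: nseq k false] rows.

Fixpoint all_bits k : seq (seq bool) :=
  if k is k'.+1 then
    [seq false :: l | l <- all_bits k'] ++ [seq true :: l | l <- all_bits k']
  else [:: [::]].

Lemma mem_all_bits l : l \in all_bits (size l).
Proof.
elim: l => //= b l IHl; rewrite mem_cat; case: b; first by rewrite map_f ?orbT.
by rewrite map_f.
Qed.

Lemma size_xorl l m : size l = size m -> size (xorl l m) = size l.
Proof. by move=> e; rewrite size_map size_zip e minnn. Qed.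

Lemma nth_xorl l m i : size l = size m ->
  nth false (xorl l m) i = nth false l i (+) nth false m i.
Proof. by elim: l m i => [|a l IHl] [|b m] [|i] //= [/IHl]. Qed.

Lemma xorl_cat l1 l2 m1 m2 : size l1 = size m1 ->
  xorl (l1 ++ l2) (m1 ++ m2) = xorl l1 m1 ++ xorl l2 m2.
Proof. by move=> e; rewrite /xorl zip_cat // map_cat. Qed.

Lemma xorl_nseq0 l : xorl l (nseq (size l) false) = l.
Proof. by elim: l => // b l IHl; rewrite /xorl /= addbF -/(xorl _ _) IHl. Qed.

Lemma in_supp_bits l i : (i \in supp (word_of_bits l)) = nth false l i.
Proof. by rewrite in_supp mxE; case: nth. Qed.

Lemma word_of_bitsD l m : size l = size m ->
  word_of_bits (xorl l m) = word_of_bits l + word_of_bits m.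
Proof.
move=> e; apply: supp_inj; apply/setP=> i.
by rewrite in_suppD !in_supp_bits nth_xorl.
Qed.

Lemma weight_bits l : size l = 24%N -> weight (word_of_bits l) = count id l.
Proof.
move=> sz; rewrite weightE -sum1_card -sum1_count (big_nth false) sz big_mkord.
by apply: eq_bigl => i; rewrite -in_supp_bits.
Qed.

Definition bits (u : word 24) : seq bool := [seq i \in supp u | i <- enum 'I_24].

Lemma size_bits u : size (bits u) = 24%N. Proof. by rewrite size_map size_enum_ord. Qed.

Lemma nth_bits u (i : 'I_24) : nth false (bits u) i = (i \in supp u).
Proof. by rewrite (nth_map i) ?size_enum_ord // nth_ord_enum. Qed.

Lemma bitsK u : word_of_bits (bits u) = u.
Proof. by apply: supp_inj; apply/setP=> i; rewrite in_supp_bits nth_bits. Qed.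

Lemma size_span_list rows k : all (fun r => size r == k) rows ->
  {in span_list rows k, forall m, size m = k}.
Proof.
elim: rows => [_ m|r rows IHr /= /andP[/eqP sr /IHr{}IHr] m].
  by rewrite inE => /eqP->; rewrite size_nseq.
rewrite mem_cat => /orP[/IHr//|/mapP[l /IHr sl ->]].
by rewrite size_xorl ?sr.
Qed.

Lemma xorl_catl t l m : size l = size m ->
  xorl (t ++ l) (nseq (size t) false ++ m) = t ++ xorl l m.
Proof. by move=> e; rewrite xorl_cat ?size_nseq // xorl_nseq0. Qed.

Definition shifted m : seq bool := nseq 8 false ++ m.

Lemma span_list_in E rows : linear_code E ->
    {in rows, forall r, size r = 16%N /\ word_of_bits (shifted r) \in E} ->
  {in span_list rows 16, forall m, word_of_bits (shifted m) \in E}.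
Proof.
move=> [E0 addE]; elim: rows => [_ m|r rows IHr rE m].
  rewrite inE => /eqP->; rewrite (_ : word_of_bits _ = 0) //.
  apply: supp_inj; rewrite supp0; apply/setP=> i.
  by rewrite in_supp_bits in_set0 nth_cat !nth_nseq !if_same.
have{}IHr : {in span_list rows 16, forall m, word_of_bits (shifted m) \in E}.
  by apply: IHr => x xr; apply: rE; rewrite inE xr orbT.
have [sr rinE] := rE r (mem_head _ _).
have srows : all (fun r => size r == 16%N) rows.
  by apply/allP => x xr; apply/eqP; case: (rE x) => //; rewrite inE xr orbT.
rewrite /= mem_cat => /orP[/IHr//|/mapP[l lr ->]].
have sl := size_span_list srows lr.
rewrite (_ : shifted _ = xorl (shifted r) (shifted l)); last by rewrite xorl_catl ?sr.
by rewrite word_of_bitsD ?size_cat ?sr ?sl // addE // IHr.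
Qed.

End BitLists.

(** * Bent functions on the sixteen labels and their 7-cliques *)

Section StandardForm.

(* The last sixteen positions are labelled by the subsets of a 4-set, the
   empty set and the singletons coming first. *)
Definition labels : seq nat := [:: 0; 1; 2; 4; 8; 3; 5; 6; 7; 9; 10; 11; 12; 13; 14; 15]%N.

Definition reed_muller : seq (seq bool) :=
  nseq 16 true :: [seq [seq odd (x %/ 2 ^ a) | x <- labels] | a <- iota 0 4]%N.

Definition rm_words := Eval vm_compute in span_list reed_muller 16.

(* A Boolean function of four variables is bent iff it is at distance at least 6
   from all affine functions. *)
Definition bent (l : seq bool) : bool := all (fun m => (6 <= count id (xorl l m))%N) rm_words.

(* Modulo affine functions a word vanishes at the first five labels. *)
Definition bent_tails : seq (seq bool) :=
  Eval vm_compute in [seq l <- all_bits 11 | bent (nseq 5 false ++ l)].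

Definition bent_tail x : seq bool := nseq 5 false ++ nth [::] bent_tails x.

Definition compatible x y : bool := bent (xorl (bent_tail x) (bent_tail y)).

Definition compatibility : seq (seq bool) :=
  Eval vm_compute in mkseq (fun x => mkseq (compatible x) 28) 28.

Definition earlier x (s : seq nat) : bool :=
  all (fun y => (x < y)%N && nth false (nth [::] compatibility x) y) s.

Definition extend_cliques (L : seq (seq nat)) : seq (seq nat) :=
  [seq x :: s | s <- L, x <- [seq x <- iota 0 28 | earlier x s]].

(** New vertices are smaller than the earlier ones and go in front, so every clique appears once, as
    an increasing list. *)
Definition cliques k : seq (seq nat) := iter k extend_cliques [:: [::]].

Lemma rm_wordsE : rm_words = span_list reed_muller 16. Proof. by vm_cast_no_check (erefl rm_words). Qed.

Lemma bent_tailsE : bent_tails = [seq l <- all_bits 11 | bent (nseq 5 false ++ l)].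
Proof. by vm_cast_no_check (erefl bent_tails). Qed.

Lemma size_bent_tails : size bent_tails = 28%N. Proof. by []. Qed.

Lemma size_bent_tail x : (x < 28)%N -> size (bent_tail x) = 16%N.
Proof.
move=> lt; have /allP/(_ (nth [::] bent_tails x)) : all (fun l => size l == 11%N) bent_tails.
  by vm_compute.
by rewrite mem_nth // => /(_ isT)/eqP e; rewrite size_cat e.
Qed.

Lemma compatibilityE x y : (x < 28)%N -> (y < 28)%N ->
  nth false (nth [::] compatibility x) y = compatible x y.
Proof.
move=> ltx lty; rewrite (_ : compatibility = mkseq (fun x => mkseq (compatible x) 28) 28).
  by rewrite !nth_mkseq.
by vm_cast_no_check (erefl compatibility).
Qed.

Lemma mem_cliques s : sorted ltn s -> {in s, forall x, (x < 28)%N} ->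
  {in s &, forall x y, x != y -> compatible x y} -> s \in cliques (size s).
Proof.
elim: s => [//|x s IHs] xs lt28 comp; have ss : sorted ltn s := path_sorted xs.
have xs' : all (ltn x) s by apply: (order_path_min ltn_trans).
have lts : {in s, forall y, (y < 28)%N} by move=> y ys; apply: lt28; rewrite inE ys orbT.
rewrite /cliques [size _]/= iterS; apply/allpairsPdep; exists s, x; split=> //.
  by apply: IHs => // y z ys zs; apply: comp; rewrite inE ?ys ?zs orbT.
have xi : x \in iota 0 28 by rewrite mem_iota add0n leq0n lt28 ?mem_head.
rewrite mem_filter xi andbT; apply/allP=> y ys.
have xy := allP xs' y ys.
rewrite -[(x < y)%N]/(ltn x y) xy compatibilityE ?(lts y ys) ?(lt28 x (mem_head _ _)) //.
by apply: comp; rewrite ?inE ?eqxx ?ys ?orbT // ltn_eqF.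
Qed.

(** The first eight positions carry the octad; this is the trace {0, j} on it. *)
Definition pair_head j : seq bool := [seq (i == 0) || (i == j) | i <- iota 0 8]%N.

(** Seven rows attach the bent functions of the clique to the pairs {0, 1}, ..., {0, 7}; the five
    rows of the Reed-Muller code vanish on the octad. *)
Definition golay_rows (q : seq nat) : seq (seq bool) :=
  [seq pair_head p.1 ++ bent_tail p.2 | p <- zip (iota 1 7) q] ++ map shifted reed_muller.

Definition first_clique : seq nat := [:: 3; 4; 10; 13; 19; 22; 24]%N.

(* The coefficients of a codeword on [golay_rows q] can be read off its bits. *)
Definition coefficients (x : seq bool) : seq bool :=
  let b := nth false x in
  [seq b i | i <- iota 1 8]%N ++ [seq b 8 (+) b i | i <- iota 9 4]%N.

Definition combine (c : seq bool) rows : seq bool :=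
  foldr (fun p m => if p.1 then xorl p.2 m else m) (nseq 24 false) (zip c rows).

Definition rearrange (P : seq nat) (x : seq bool) : seq bool := [seq nth false x k | k <- P].

(** In terms of labels these are the linear maps that fix the hyperplane of labels below 8 pointwise
    and add a constant of that hyperplane, in the order 0, 7, 6, 1, 2, 5, 4, 3, to every other
    label. The octad is fixed. *)
Definition clique_perms : seq (seq nat) :=
  map (cat (iota 0 12))
  [:: [:: 12; 13; 14; 15; 16; 17; 18; 19; 20; 21; 22; 23];
      [:: 23; 13; 14; 15; 16; 22; 21; 20; 19; 18; 17; 12];
      [:: 22; 13; 14; 15; 16; 23; 20; 21; 18; 19; 12; 17];
      [:: 17; 13; 14; 15; 16; 12; 19; 18; 21; 20; 23; 22];
      [:: 18; 13; 14; 15; 16; 19; 12; 17; 22; 23; 20; 21];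
      [:: 21; 13; 14; 15; 16; 20; 23; 22; 17; 12; 19; 18];
      [:: 20; 13; 14; 15; 16; 21; 22; 23; 12; 17; 18; 19];
      [:: 19; 13; 14; 15; 16; 18; 17; 12; 23; 22; 21; 20]]%N.

Definition is_perm_list (P : seq nat) : bool :=
  [&& size P == 24%N, uniq P & all (fun k => (k < 24)%N) P].

(** The cliques and [clique_perms] are listed in matching order; a finite check shows that the
    rearranged reference generators are combinations of the rows of [q]. *)
Lemma clique_permsP q : q \in cliques 7 ->
  exists P, [/\ is_perm_list P, nth 0%N P 0 = 0%N
    & {in golay_rows first_clique, forall g,
        combine (coefficients (rearrange P g)) (golay_rows q) = rearrange P g}].
Proof.
have check : all (fun p => [&& is_perm_list p.2, nth 0%N p.2 0 == 0%N
    & all (fun g => combine (coefficients (rearrange p.2 g)) (golay_rows p.1) == rearrange p.2 g)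
        (golay_rows first_clique)]) (zip (cliques 7) clique_perms).
  by vm_cast_no_check (erefl true).
have sz : size (cliques 7) = size clique_perms by vm_cast_no_check (erefl 8%N).
move: (cliques 7) clique_perms check sz => L perms check sz qL; pose i := index q L.
have lti : (i < size (zip L perms))%N by rewrite size1_zip ?index_mem ?sz.
have := all_nthP ([::], [::]) check i lti; rewrite nth_zip // nth_index //.
move=> /and3P[pP /eqP P0 gP]; exists (nth [::] perms i); split=> // g gg.
exact/eqP/(allP gP g gg).
Qed.

End StandardForm.

Section PermuteCode.

Variable n : nat.
Implicit Types (s t : 'S_n) (u v : word n) (E : code n).

Lemma in_supp_col_perm s u i : (i \in supp (col_perm s u)) = (s i \in supp u).
Proof. by rewrite !in_supp mxE. Qed.

Lemma col_permD s u v : col_perm s (u + v) = col_perm s u + col_perm s v.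
Proof. by apply/rowP=> i; rewrite !mxE. Qed.

Lemma weight_col_perm s u : weight (col_perm s u) = weight u.
Proof.
rewrite !weightE -(card_imset _ (@perm_inj _ s)); apply: eq_card => i.
apply/imsetP/idP => [[j ju ->]|iu]; first by rewrite -in_supp_col_perm.
by exists (s^-1 i)%g; rewrite ?in_supp_col_perm permKV.
Qed.

Lemma col_permK s : cancel (fun u => col_perm s u) (col_perm s^-1).
Proof. by move=> u; rewrite -col_permM mulVg col_perm1. Qed.

Lemma mem_permute_code s E u : (u \in permute_code s E) = (col_perm s^-1 u \in E).
Proof.
apply/imsetP/idP => [[v vE ->]|uE]; first by rewrite col_permK.
by exists (col_perm s^-1 u); rewrite // -col_permM mulgV col_perm1.
Qed.

Lemma mem_permute_codeV s E u : (u \in permute_code s^-1 E) = (col_perm s u \in E).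
Proof. by rewrite mem_permute_code invgK. Qed.

Lemma permute_codeM s t E : permute_code s (permute_code t E) = permute_code (s * t) E.
Proof.
by apply/setP=> u; rewrite !mem_permute_code invMg col_permM.
Qed.

Lemma linear_permute_code s E : linear_code E -> linear_code (permute_code s E).
Proof.
move=> [E0 addE]; split=> [|u v]; rewrite !mem_permute_code.
  by rewrite (_ : col_perm _ _ = 0) //; apply/rowP=> i; rewrite !mxE.
by move=> uE vE; rewrite col_permD addE.
Qed.

Lemma card_permute_code s E : #|permute_code s E| = #|E|.
Proof. by rewrite card_imset //; apply: can_inj (col_permK s). Qed.

End PermuteCode.

Lemma golay_like_permute s E : golay_like E -> golay_like (permute_code s E).
Proof.
move=> [linE cE dbl dist]; split; first exact: linear_permute_code.
- by rewrite card_permute_code.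
- by move=> x; rewrite mem_permute_code => /dbl; rewrite weight_col_perm.
move=> x; rewrite mem_permute_code => xE; rewrite -(weight_col_perm s^-1) => x0; apply: dist => //.
by rewrite -weight_eq0 weight_col_perm weight_eq0.
Qed.

Lemma perm_of_list P : is_perm_list P -> exists s : 'S_24, forall i : 'I_24, s i = nth 0%N P i :> nat.
Proof.
move=> /and3P[/eqP sz uP /allP ltP]; pose f (i : 'I_24) : 'I_24 := inord (nth 0%N P i).
have fE i : f i = nth 0%N P i :> nat by rewrite inordK // ltP // mem_nth // sz.
have injf : injective f.
  move=> i j eq_ij; apply/val_inj/eqP.
  by rewrite /= -(nth_uniq 0%N _ _ uP) ?sz ?ltn_ord // -!fE eq_ij.
by exists (perm injf) => i; rewrite permE.
Qed.

Lemma col_perm_bits (s : 'S_24) P l : size P = 24%N -> (forall i : 'I_24, s i = nth 0%N P i :> nat) ->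
  col_perm s (word_of_bits l) = word_of_bits (rearrange P l).
Proof.
move=> sz sP; apply: supp_inj; apply/setP=> i.
by rewrite in_supp_col_perm !in_supp_bits (nth_map 0%N) ?sz // sP.
Qed.

Lemma combine_in (E : code 24) c rows : linear_code E ->
    {in rows, forall r, size r = 24%N /\ word_of_bits r \in E} ->
  size (combine c rows) = 24%N /\ word_of_bits (combine c rows) \in E.
Proof.
move=> [E0 addE].
have base : size (nseq 24 false) = 24%N /\ word_of_bits (nseq 24 false) \in E.
  rewrite size_nseq (_ : word_of_bits _ = 0) //; apply: supp_inj; rewrite supp0.
  by apply/setP=> i; rewrite in_supp_bits in_set0 nth_nseq if_same.
elim: c rows => [|b c IHc] [|r rows] rE //.
have [] := IHc rows; first by move=> x xr; apply: rE; rewrite inE xr orbT.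
rewrite /combine /=; set m := foldr _ _ _ => sm mE; case: b => //=.
have [sr rinE] := rE r (mem_head _ _).
by rewrite size_xorl ?sr // word_of_bitsD ?sr // addE.
Qed.

(** * From the Reed-Muller words to a clique of bent functions *)

Section Standardised.

Variable E : code 24.
Hypothesis golE : golay_like E.
Hypothesis rmE : {in reed_muller, forall r, word_of_bits (shifted r) \in E}.

Let linE : linear_code E. Proof. by case: golE. Qed.
Let addE : {in E &, forall u v, u + v \in E}. Proof. by case: linE. Qed.
Let dblE : {in E, forall x, (4 %| weight x)%N}. Proof. by case: golE. Qed.

Let size_rm : {in reed_muller, forall r, size r = 16%N}.
Proof. by move=> r /(allP (isT : all (fun r => size r == 16%N) reed_muller))/eqP. Qed.

Let rm_wordsE m : m \in rm_words -> size m = 16%N /\ word_of_bits (shifted m) \in E.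
Proof.
rewrite rm_wordsE => mR; split.
  by apply: (@size_span_list reed_muller 16) => //; apply/allP => r /size_rm->.
by apply: span_list_in mR => // r rr; rewrite size_rm // rmE.
Qed.

(** Adding any affine function to [l] gives a codeword of weight at least 8, of which only 2 lie on
    the octad. *)
Let bent_in t l : size t = 8%N -> count id t = 2%N -> size l = 16%N ->
  word_of_bits (t ++ l) \in E -> bent l.
Proof.
move=> st ct sl tlE; apply/allP => m /rm_wordsE[sm mE].
have tmE : word_of_bits (t ++ xorl l m) \in E.
  have e : size (t ++ l) = size (shifted m) by rewrite !size_cat size_nseq st sl sm.
  rewrite (_ : t ++ _ = xorl (t ++ l) (shifted m)) ?word_of_bitsD ?addE //.
  by rewrite /shifted -{1}st xorl_catl ?sl ?sm.
have sz : size (t ++ xorl l m) = 24%N by rewrite size_cat st size_xorl ?sl ?sm.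
have wE := weight_bits sz; rewrite count_cat ct in wE.
have ne0 : word_of_bits (t ++ xorl l m) != 0 by rewrite -weight_eq0 wE.
by case: golE => _ _ _ /(_ _ tmE ne0); rewrite wE.
Qed.

Let even_dot : {in E &, forall x y, dot x y = false}.
Proof. exact: doubly_even_orthogonal. Qed.

Let dualE : dual_code E = E.
Proof. by case: golE => _ cE _ _; apply: (@self_dual 24 12). Qed.

Let octad : word 24 := word_of_bits (nseq 8 true ++ nseq 16 false).

Let onesE : ones 24 \in E.
Proof. by rewrite -dualE ones_in_dual // => x /dblE; lia. Qed.

Let octadE : octad \in E.
Proof.
rewrite (_ : octad = ones 24 + word_of_bits (shifted (nseq 16 true))); first by rewrite addE ?rmE.
apply: supp_inj; apply/setP=> i; rewrite in_suppD !in_supp_bits supp_ones.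
by case: i; do 24?[case=> //].
Qed.

(** The bits at the octad positions 1 to 7 can be prescribed, since no nonzero codeword fits into
    seven points. Orthogonality to the octad then fixes the bit at 0, and a Reed-Muller word
    normalises the tail. *)
Let tail_exists (j : 'I_7) : exists x : 'I_28, word_of_bits (pair_head j.+1 ++ bent_tail x) \in E.
Proof.
pose S : {set 'I_24} := [set i : 'I_24 | (0 < i < 8)%N].
have cS : #|S| = 7%N by rewrite -sum1dep_card big_mkcond !big_ord_recr big_ord0.
have freeS c : c \in E -> supp c \subset S -> c = 0.
  move=> cE /subset_leq_card; rewrite cS -weightE => le; apply/eqP; apply: contraTT le => c0.
  by rewrite -ltnNge; case: golE => _ _ _ /(_ c cE c0).
have subE : dual_code E \subset E by rewrite dualE.
have [c cE agr] := fibre_exists (word_of_bits (pair_head j.+1)) linE subE freeS.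
pose t := take 8 (bits c); pose l := drop 8 (bits c).
have st : size t = 8%N by rewrite size_takel ?size_bits.
have sl : size l = 16%N by rewrite size_drop size_bits.
have ct : word_of_bits (t ++ l) = c by rewrite cat_take_drop bitsK.
have even_t : ~~ odd (count id t).
  have -> : count id t = #|supp c :&: supp octad|.
    have -> : count id t = count id (t ++ nseq 16 false) by rewrite count_cat addn0.
    rewrite -weight_bits ?size_cat ?size_nseq ?st // weightE; congr #|pred_of_set _|.
    apply/setP=> i; rewrite in_setI -ct !in_supp_bits !nth_cat st size_nseq !nth_nseq !if_same.
    by case: ltnP; rewrite ?andbT ?andbF // => ->.
  by rewrite -[odd _]/(dot c octad) even_dot.
have tE : t = nth false t 0 :: [seq i == j.+1 | i <- iota 1 7].
  apply: (@eq_from_nth _ false) => [|i]; rewrite st // => lti8.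
  case: i lti8 => [//|i] lti8; rewrite -[RHS]/(nth false [seq i == j.+1 | i <- iota 1 7] i).
  rewrite (nth_map 0%N) ?size_iota // nth_iota // add1n.
  have lt24 : (i.+1 < 24)%N by apply: leq_trans lti8 _.
  have := agr (Ordinal lt24); rewrite inE lti8 => /(_ isT).
  rewrite -ct !in_supp_bits nth_cat st lti8 => ->.
  by rewrite /pair_head (nth_map 0%N) ?size_iota // nth_iota.
have{}tE : t = pair_head j.+1.
  rewrite tE /pair_head /=; congr (_ :: _); apply: contraNT even_t => /negbTE t0.
  by rewrite tE t0; case: (j); do 7?[case=> //].
(* The first five labels are 0 and the unit vectors, where an affine function takes arbitrary
   values. *)
have [m mR m5] : exists2 m, m \in rm_words & xorl (take 5 l) (take 5 m) = nseq 5 false.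
  have check : all (fun v => has (fun m => xorl v (take 5 m) == nseq 5 false) rm_words) (all_bits 5).
    by vm_compute.
  have s5 : size (take 5 l) = 5%N by rewrite size_takel ?sl.
  have := mem_all_bits (take 5 l); rewrite s5 => /(allP check)/hasP[m mR /eqP m5].
  by exists m.
have [sm mE] := rm_wordsE mR.
pose l' := xorl (drop 5 l) (drop 5 m).
have sd (x : seq bool) : size x = 16%N -> size (drop 5 x) = 11%N by rewrite size_drop => ->.
have sl' : size l' = 11%N by rewrite size_xorl !sd.
have lm : xorl l m = nseq 5 false ++ l'.
  rewrite -m5 -xorl_cat ?cat_take_drop //.
  by rewrite !size_takel ?sl ?sm.
have wE : word_of_bits (pair_head j.+1 ++ nseq 5 false ++ l') \in E.
  rewrite -lm -tE -xorl_catl ?sl ?sm // st word_of_bitsD; last first.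
    by rewrite !size_cat size_nseq st sl sm.
  by rewrite ct addE.
have l'B : l' \in bent_tails.
  rewrite bent_tailsE mem_filter -sl' mem_all_bits andbT.
  apply: bent_in wE; rewrite ?size_cat ?sl' ?size_nseq //.
  by case: (j); do 7?[case=> //].
have ltx : (index l' bent_tails < 28)%N by rewrite -size_bent_tails index_mem.
by exists (Ordinal ltx); rewrite /bent_tail nth_index.
Qed.

(** The sum of two of the seven rows has weight 2 on the octad, so the tails are pairwise
    compatible. Putting them in increasing order amounts to permuting the octad points 1 to 7. *)
Lemma standardised_clique : exists s : 'S_24, exists2 q, q \in cliques 7 &
  s ord0 = ord0 /\ {in golay_rows q, forall r, size r = 24%N /\ word_of_bits r \in permute_code s E}.
Proof.
have [b bE] := fin_all_exists tail_exists.
have comp j k : j != k -> compatible (b j) (b k).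
  move=> jk; pose t := xorl (pair_head j.+1) (pair_head k.+1).
  apply: (@bent_in t); rewrite ?size_xorl ?size_bent_tail ?ltn_ord //.
    have check : all (fun j => all (fun k =>
        (j != k) ==> (count id (xorl (pair_head j.+1) (pair_head k.+1)) == 2)) (iota 0 7)) (iota 0 7).
      by vm_compute.
    have mem7 (i : 'I_7) : (i : nat) \in iota 0 7 by rewrite mem_iota ltn_ord.
    by apply/eqP; have := allP (allP check j (mem7 j)) k (mem7 k); rewrite /= (inj_eq val_inj) jk.
  rewrite -xorl_cat // word_of_bitsD ?addE //.
  by rewrite [LHS]size_cat [RHS]size_cat !size_bent_tail ?ltn_ord.
(* Equal tails have sum 0, which is not bent. *)
have inj_b : injective (fun j => val (b j)).
  move=> j k eq_jk; apply/eqP; apply: contraT => /comp; rewrite /= in eq_jk; rewrite eq_jk.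
  have check : all (fun x => ~~ compatible x x) (iota 0 28) by vm_compute.
  by apply/contraLR => _; apply: (allP check); rewrite mem_iota ltn_ord.
pose bs := [tuple val (b j) | j < 7]; pose q := sort leq bs.
have /tuple_permP[p qE] : perm_eq q bs by rewrite perm_sort.
have{}qE : q = [seq val (b (p i)) | i <- enum 'I_7].
  by rewrite qE; apply: eq_map => i; rewrite tnth_mktuple.
have in_q x : x \in q -> exists j, x = val (b j) by rewrite qE => /mapP[i _ ->]; exists (p i).
have size_q : size q = 7%N by rewrite qE size_map size_enum_ord.
have qC : q \in cliques 7.
  rewrite -size_q; apply: mem_cliques => [|x /in_q[j ->]|x y /in_q[j ->] /in_q[k ->] ne].
  - rewrite ltn_sorted_uniq_leq sort_sorted ?andbT; last exact: leq_total.
    rewrite qE map_inj_uniq ?enum_uniq //.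
    by move=> i j /inj_b/perm_inj.
  - exact: ltn_ord.
  by apply: comp; apply: contraNneq ne => ->.
(* The sorting permutation acts on the octad points other than 0; the labelled positions stay
   fixed. *)
pose P := 0%N :: [seq (p i).+1 | i <- enum 'I_7] ++ iota 8 16.
have permP : is_perm_list P.
  have : [/\ size (iota 8 16) = 16%N, uniq (iota 8 16) & iota 8 16 =i [pred x | 8 <= x < 24]%N].
    by rewrite size_iota iota_uniq; split=> // x; rewrite mem_iota.
  rewrite /is_perm_list /P; move: (iota 8 16) => I [sI uI memI].
  rewrite /= size_cat size_map size_enum_ord sI cat_uniq uI mem_cat memI orbF andbT.
  rewrite map_inj_uniq ?enum_uniq; last by move=> i j [/val_inj/perm_inj].
  rewrite all_cat andTb; apply/and4P; split; [by [] | | |].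
  - apply/andP; split; first by apply/mapP => -[].
    apply/hasPn => x; rewrite memI => /andP[le8 _]; apply/mapP => -[i _ xE].
    by move: le8; rewrite xE ltnS leqNgt ltn_ord.
  - apply/allP => _ /mapP[i _ ->]; have := ltn_ord (p i); lia.
  by apply/allP => x; rewrite memI => /andP[].
have [s sP] := perm_of_list permP; have /and3P[/eqP sizeP _ _] := permP.
have rearr t l : size t = 8%N -> size l = 16%N ->
    rearrange P (t ++ l) = nth false t 0 :: [seq nth false t (p i).+1 | i <- enum 'I_7] ++ l.
  move=> st sl; rewrite -[LHS]/(nth false (t ++ l) 0 ::
      [seq nth false (t ++ l) k | k <- [seq (p i).+1 | i <- enum 'I_7] ++ iota 8 16]).
  rewrite nth_cat st map_cat; congr (_ :: _ ++ _).
    by rewrite -map_comp; apply: eq_map => i /=; rewrite nth_cat st ltnS ltn_ord.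
  rewrite -[iota 8 16]/(iota (8 + 0) 16) iotaDl -map_comp -[RHS](mkseq_nth false) sl.
  by apply: eq_map => i /=; rewrite nth_cat st ltnNge leq_addr /= addKn.
have moved t l : size t = 8%N -> size l = 16%N -> word_of_bits (t ++ l) \in E ->
    word_of_bits (nth false t 0 :: [seq nth false t (p i).+1 | i <- enum 'I_7] ++ l)
      \in permute_code s E.
  move=> st sl tlE; rewrite -rearr // -(col_perm_bits _ sizeP sP).
  exact: imset_f.
exists s; exists q; first exact: qC.
clear qC; split; first by apply: val_inj; rewrite /= sP.
move=> r; rewrite mem_cat => /orP[/mapP[[j x] /(nthP (0, 0)%N)[i] ]|/mapP[l lR ->]].
  rewrite size_zip size_iota size_q => lti.
  rewrite nth_zip ?size_iota ?size_q // nth_iota // => -[<- <-] ->.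
  rewrite add1n qE (nth_map (Ordinal lti)) ?size_enum_ord //.
  rewrite (nth_ord_enum (Ordinal lti) (Ordinal lti)) size_cat size_bent_tail ?ltn_ord //; split=> //.
  have sH k : size (pair_head k) = 8%N by [].
  have st : size (bent_tail (b (p (Ordinal lti)))) = 16%N := size_bent_tail (ltn_ord _).
  pose t := pair_head (p (Ordinal lti)).+1.
  have -> : pair_head i.+1 = nth false t 0 :: [seq nth false t (p k).+1 | k <- enum 'I_7].
    rewrite -[LHS]/(true :: [seq k == i.+1 | k <- iota (1 + 0) 7]); congr (_ :: _).
    rewrite iotaDl -val_enum_ord -!map_comp.
    apply: eq_map => k; rewrite /t /pair_head -[LHS]/((k : nat).+1 == i.+1).
    rewrite -[RHS]/(nth false [seq (x == 0) || (x == (p (Ordinal lti)).+1) | x <- iota 0 8]%N (p k).+1).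
    have lt8 : ((p k).+1 < 8)%N := ltn_ord (p k).
    rewrite (nth_map 0%N) ?size_iota // nth_iota // add0n.
    rewrite -[LHS]/(k == Ordinal lti) -[RHS]/(p k == p (Ordinal lti)).
    by rewrite (inj_eq (@perm_inj _ p)).
  exact: (moved _ _ (sH _) st (bE (p (Ordinal lti)))).
have sl := size_rm lR; split; first by rewrite size_cat size_nseq sl.
have -> : shifted l = nth false (nseq 8 false) 0
    :: [seq nth false (nseq 8 false) (p k).+1 | k <- enum 'I_7] ++ l.
  rewrite (eq_map (g := fun=> false)); last by move=> i; rewrite nth_nseq if_same.
  have const (T : Type) (x : seq T) : [seq false | _ <- x] = nseq (size x) false.
    by elim: x => //= ? x ->.
  by rewrite const size_enum_ord.
exact: (moved _ _ (size_nseq 8 false) sl (rmE lR)).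
Qed.

End Standardised.

Definition golay_code : {vspace word 24} :=
  <<map word_of_bits (golay_rows first_clique)>>%VS.

Lemma span_sub_code n (X : seq (word n)) (E : code n) : linear_code E ->
  {in X, forall x, x \in E} -> code_of <<X>> \subset E.
Proof.
move=> [E0 addE] XE; apply/subsetP => v; rewrite inE; move: v.
by apply: span_ind.
Qed.

(* In each row of the list the first position listed has a bit that vanishes in
   all later rows. *)
Fixpoint has_pivots (rows : seq (seq bool)) (ps : seq nat) : bool :=
  match rows, ps with
  | r :: rows', p :: ps' =>
      [&& (p < 24)%N, nth false r p, all (fun r' => ~~ nth false r' p) rows' & has_pivots rows' ps']
  | [::], [::] => true
  | _, _ => false
  end.

Lemma has_pivots_free rows ps : has_pivots rows ps -> free (map word_of_bits rows).
Proof.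
elim: rows ps => [|r rows IHr] [|p ps] //=; first by rewrite nil_free.
move=> /and4P[ltp rp /allP rowsp /IHr fr]; rewrite free_cons fr andbT.
apply/negP => rin; suff : Ordinal ltp \notin supp (word_of_bits r) by rewrite in_supp_bits rp.
move: {rp fr IHr} (word_of_bits r) rin; apply: span_ind => [|u v up vp|_ /mapP[r' /rowsp r'p ->]].
- by rewrite supp0 inE.
- by rewrite in_suppD (negbTE up).
by rewrite in_supp_bits.
Qed.

Lemma mem_span_bits rows : all (fun r => size r == 24%N) rows ->
  forall v, v \in <<map word_of_bits rows>>%VS ->
  exists2 m, m \in span_list rows 24 & v = word_of_bits m.
Proof.
elim: rows => [_ v|r rows IHr /= /andP[/eqP sr srows] v].
  rewrite span_nil memv0 => /eqP->; exists (nseq 24 false); first by rewrite inE.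
  by apply: supp_inj; apply/setP=> i; rewrite in_supp_bits nth_nseq if_same supp0 inE.
rewrite span_cons => /memv_addP[_ /vlineP[k ->]] [w /(IHr srows)[m mR ->] ->].
case: (F2_cases k) => ->; first by exists m; rewrite ?scale0r ?add0r // mem_cat mR.
exists (xorl r m); first by rewrite mem_cat map_f ?orbT.
by rewrite scale1r word_of_bitsD // sr (size_span_list srows mR).
Qed.

Lemma dim_golay_code : \dim golay_code = 12%N.
Proof.
have fr : free (map word_of_bits (golay_rows first_clique)).
  (* The pivots are the octad points 1 to 7 for the pair rows, label 0 for the all-one row and the
     unit vectors for the coordinate functions. *)
  apply: (@has_pivots_free _ ([:: 1; 2; 3; 4; 5; 6; 7; 8; 9; 10; 11; 12]%N)).
  by vm_cast_no_check (erefl true).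
by rewrite -[RHS]/(size (map word_of_bits (golay_rows first_clique))) -(eqP fr).
Qed.

Lemma weights_golay_code :
  {in golay_code, forall v, weight v \in [:: 0; 8; 12; 16; 24]%N}.
Proof.
have check : all (fun m => (size m == 24%N) && (count id m \in [:: 0; 8; 12; 16; 24]%N))
    (span_list (golay_rows first_clique) 24).
  by vm_cast_no_check (erefl true).
have srows : all (fun r => size r == 24%N) (golay_rows first_clique).
  by vm_cast_no_check (erefl true).
move=> v /(mem_span_bits srows)[m mR ->].
by have /andP[/eqP sm wm] := allP check m mR; rewrite weight_bits.
Qed.

Lemma golay_like_golay_code : golay_like (code_of golay_code).
Proof.
split; first exact: linear_code_of.
- by rewrite card_code_of dim_golay_code.
- by move=> x; rewrite inE => /weights_golay_code; rewrite !inE => /or4P[| | |/orP[]] /eqP->.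
move=> x; rewrite inE -weight_eq0 => /weights_golay_code.
by rewrite !inE => /or4P[| | |/orP[]] /eqP->.
Qed.

Lemma is_extended_golay_code : is_extended_golay golay_code.
Proof.
have [_ _ _ dist] := golay_like_golay_code; split; first exact: dim_golay_code.
have add u v : u \in code_of golay_code -> v \in code_of golay_code -> u + v \in code_of golay_code.
  by case: (linear_code_of golay_code) => _; apply.
split=> [u v uV vV uv|].
  rewrite hammingE dist ?add //; apply: contraNneq uv => uv0.
  by rewrite -(word_addrK v u) /= uv0 add0r.
(* A coordinate function takes the value 1 at eight labels, so its distance to 0 is exactly 8. *)
pose r := shifted (nth [::] reed_muller 1); exists (word_of_bits r), 0.
have rG : word_of_bits r \in code_of golay_code.
  by rewrite inE memv_span // map_f //; vm_cast_no_check (erefl true).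
have sr : size r = 24%N by vm_cast_no_check (erefl 24%N).
have wr : weight (word_of_bits r) = 8%N by rewrite (weight_bits sr); vm_cast_no_check (erefl 8%N).
split=> //; first by rewrite inE mem0v.
  by rewrite -weight_eq0 wr.
by rewrite hammingE addr0.
Qed.

(** One permutation brings the code to the rows of some clique, another matches this clique with the
    reference clique. The resulting inclusion is an equality because both codes have 2^12 words. *)
Lemma standardised_unique E : golay_like E ->
    {in reed_muller, forall r, word_of_bits (shifted r) \in E} ->
  exists2 s : 'S_24, s ord0 = ord0 & permute_code s E = code_of golay_code.
Proof.
move=> golE rmE; have [s1 [q qC [s10 rowsE1]]] := standardised_clique golE rmE.
have [P [permP P0 redP]] := clique_permsP qC; have [s2 s2P] := perm_of_list permP.
have /and3P[/eqP sizeP _ _] := permP; clear qC permP.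
have golE1 := golay_like_permute s1 golE; set E1 := permute_code s1 E in golE1 rowsE1.
have s20 : s2 ord0 = ord0 by apply: val_inj; rewrite /= s2P.
exists (s2^-1 * s1)%g; first by rewrite permM -{1}s20 permK.
rewrite -permute_codeM -/E1; apply/eqP; rewrite eq_sym eqEcard; apply/andP; split.
  apply: span_sub_code; first by case: (golay_like_permute s2^-1 golE1).
  move=> _ /mapP[g gG ->]; rewrite mem_permute_codeV (col_perm_bits _ sizeP s2P) -redP //.
  by have [linE1 _ _ _] := golE1; case: (combine_in (coefficients (rearrange P g)) linE1 rowsE1).
by rewrite !card_permute_code card_code_of dim_golay_code; case: golE => _ ->.
Qed.

Lemma weight_col' n (i : 'I_n) (u : word n) :
  weight u = ((i \in supp u) + weight (col' i u))%N.
Proof.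
rewrite !weightE (cardsD1 i); congr (_ + _)%N.
rewrite -(card_imset _ (@lift_inj _ i)); apply: eq_card => j; rewrite in_setD1.
apply/andP/imsetP => [[ji ju]|[k ku ->]].
  case: (unliftP i j) ji ju => [k ->|->]; last by rewrite eqxx.
  by move=> _ ju; exists k; rewrite // in_supp mxE -in_supp.
by rewrite eq_sym neq_lift; split; rewrite // in_supp; move: ku; rewrite in_supp mxE.
Qed.

Lemma col'D n (i : 'I_n) (u v : word n) : col' i (u + v) = col' i u + col' i v.
Proof. by apply/rowP=> j; rewrite !mxE. Qed.

Section Punctured.

Variables (E : code 24) (i : 'I_24).
Hypotheses (linE : linear_code E) (cardE : #|E| = (2 ^ 12)%N).
Hypothesis distE : {in E, forall x, x != 0 -> (8 <= weight x)%N}.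

Let col'_weight u : u \in E -> u != 0 -> (7 <= weight (col' i u))%N.
Proof. by move=> uE /(distE uE); rewrite (weight_col' i); case: (i \in _) => // /ltnW. Qed.

Lemma linear_puncture : linear_code (puncture i E).
Proof.
case: linE => E0 addE; split=> [|_ _ /imsetP[u uE ->] /imsetP[v vE ->]].
  by apply/imsetP; exists 0 => //; apply/rowP=> j; rewrite !mxE.
by rewrite -col'D imset_f // addE.
Qed.

Lemma dist_puncture : {in puncture i E, forall x, x != 0 -> (7 <= weight x)%N}.
Proof.
move=> _ /imsetP[u uE ->] x0; apply: col'_weight => //; apply: contraNneq x0 => ->.
by apply/eqP/rowP=> j; rewrite !mxE.
Qed.

Lemma card_puncture : #|puncture i E| = (2 ^ 12)%N.
Proof.
rewrite card_in_imset // => u v uE vE eq_uv; apply/eqP; rewrite -(inj_eq (addrI v)) word_addrr.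
have vuE : v + u \in E by case: linE => _; apply.
apply: contraT => /(col'_weight vuE); rewrite col'D eq_uv word_addrr.
by rewrite weightE supp0 cards0.
Qed.

End Punctured.

(** Adjoining a word of [K] outside [A] doubles [A]. Generation is phrased through all linear codes
    [Q] so that it can be applied to the code of words taking equal values at two points. *)
Lemma generators n m (A K : code n) : linear_code A -> linear_code K -> A \subset K ->
    #|K| = (2 ^ m * #|A|)%N ->
  exists t : seq (word n), [/\ size t = m, {subset t <= K} & forall Q : code n,
    linear_code Q -> A \subset Q -> {subset t <= Q} -> K \subset Q].
Proof.
elim: m A => [|m IHm] A linA linK sAK cK.
  exists [::]; split=> // Q _ sAQ _; rewrite (_ : K = A) //; apply/eqP.
  by rewrite eq_sym eqEcard sAK cK mul1n leqnn.
have [f fK fA] : exists2 f, f \in K & f \notin A.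
  apply/subsetPn; apply: contraTN isT => sKA; have := subset_leq_card sKA.
  have [A0 _] := linA; have : (0 < #|A|)%N by apply/card_gt0P; exists 0.
  rewrite cK expnS -mulnA mul2n -addnn => Apos; have := expn_gt0 2 m; nia.
have [A0 addA] := linA; have [_ addK] := linK.
pose A' := A :|: [set f + a | a in A].
have linA' : linear_code A'.
  split=> [|u v]; first by rewrite in_setU A0.
  rewrite !in_setU => /orP[uA|/imsetP[a aA ->]] /orP[vA|/imsetP[b bA ->]].
  - by rewrite addA.
  - by rewrite addrCA imset_f ?orbT // addA.
  - by rewrite -addrA imset_f ?orbT // addA.
  - by rewrite addrACA word_addrr add0r addA.
have sA'K : A' \subset K.
  rewrite subUset sAK; apply/subsetP=> _ /imsetP[a aA ->].
  by rewrite addK // (subsetP sAK).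
have cA' : #|A'| = (2 * #|A|)%N.
  rewrite cardsU (_ : A :&: _ = set0) ?cards0 ?subn0 ?card_imset ?mul2n ?addnn //; first exact: addrI.
  apply/setP=> a; rewrite in_setI in_set0; apply/negbTE/andP=> -[aA /imsetP[b bA ab]].
  by case/negP: fA; rewrite -(word_addrK b f) /= -ab addA.
have [|t [st tK gen]] := IHm A' linA' linK sA'K; first by rewrite cA' cK expnSr mulnA.
exists (f :: t); split=> [|x|Q linQ sAQ tQ]; first by rewrite /= st.
  by rewrite inE => /predU1P[->|/tK].
apply: gen => // [|x xt]; last by apply: tQ; rewrite inE xt orbT.
rewrite subUset sAQ; apply/subsetP=> _ /imsetP[a aA ->]; case: linQ => _; apply.
  by apply: tQ; rewrite mem_head.
by apply: (subsetP sAQ).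
Qed.

Lemma disjoint_notinP (T : finType) (A B : {set T}) :
  reflect {in A, forall i, i \notin B} [disjoint A & B].
Proof. by rewrite disjoint_subset; apply: subsetP. Qed.

(** * Octads and the labelling of the complementary sixteen points *)

Section Labelling.

Variables (E : code 24) (p : 'I_24).
Hypothesis golE : golay_like E.

Let linE : linear_code E. Proof. by case: golE. Qed.
Let addE : {in E &, forall u v, u + v \in E}. Proof. by case: linE. Qed.
Let dblE : {in E, forall x, (4 %| weight x)%N}. Proof. by case: golE. Qed.
Let cardE : #|E| = (2 ^ 12)%N. Proof. by case: golE. Qed.
Let distE : {in E, forall x, x != 0 -> (8 <= weight x)%N}. Proof. by case: golE. Qed.

Let even_dot : {in E &, forall x y, dot x y = false}.
Proof. exact: doubly_even_orthogonal. Qed.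

Let dualE : dual_code E = E. Proof. exact: (@self_dual 24 12). Qed.

Let subE : dual_code E \subset E. Proof. by rewrite dualE. Qed.

Let onesE : ones 24 \in E.
Proof. by rewrite -dualE ones_in_dual // => x /dblE; lia. Qed.

(** In the code punctured at [p], a word of weight 4 is within distance 3 of a codeword, which must
    have weight 7. Divisibility by 4 puts [p] into its extension. *)
Lemma octad_through : exists o, [/\ o \in E, weight o = 8%N & p \in supp o].
Proof.
pose x : word 23 := word_of [set i : 'I_23 | (i < 4)%N].
have wx : weight x = 4%N.
  by rewrite weightE supp_word_of -sum1dep_card big_mkcond !big_ord_recr big_ord0.
have [c cP wxc] := perfect_covering (linear_puncture p linE) (card_puncture p linE cardE distE)
  (@dist_puncture E p distE) x.
have c0 : c != 0 by apply: contraTneq wxc => ->; rewrite addr0 wx.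
have ge7 : (7 <= weight c)%N := dist_puncture distE cP c0.
have w7 : weight c = 7%N.
  have := weightD x c; have := subset_leq_card (subsetIl (supp x) (supp c)).
  rewrite -weightE wx; move: (weight (x + c)) wxc (weight c) ge7 #|_|; clear; lia.
case/imsetP: cP => o oE cE; exists o.
have wo : weight o = ((p \in supp o) + weight c)%N by rewrite cE; apply: weight_col'.
by have := dblE oE; rewrite wo w7; case: (p \in supp o).
Qed.

Section Octad.

Variable o : word 24.
Hypotheses (oE : o \in E) (wo : weight o = 8%N) (po : p \in supp o).

Let K : code 24 := [set c in E | [disjoint supp c & supp o]].

Let in_K c : (c \in K) = (c \in E) && [disjoint supp c & supp o].
Proof. by rewrite in_set. Qed.

Let linK : linear_code K.
Proof.
case: linE => E0 _; split=> [|u v].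
  by rewrite in_K E0 supp0 -setI_eq0 set0I eqxx.
rewrite !in_K => /andP[uE du] /andP[vE dv]; rewrite addE //=; apply/disjoint_notinP=> i.
rewrite in_suppD; apply: contraL => io.
by rewrite (disjointFl du io) (disjointFl dv io).
Qed.

Let small_free (S : {set 'I_24}) : (#|S| < 8)%N -> forall c, c \in E -> supp c \subset S -> c = 0.
Proof.
move=> ltS c cE /subset_leq_card le; apply: contraTeq ltS => c0.
by rewrite -leqNgt (leq_trans (distE cE c0)).
Qed.

Let S7 := supp o :\ p.

Let cardS7 : #|S7| = 7%N.
Proof. by have := cardsD1 p (supp o); rewrite po -weightE wo => -[]. Qed.

(* A codeword meets the octad in an even number of points. *)
Let inK_S7 c : c \in E -> {in S7, forall i, (i \in supp c) = false} -> c \in K.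
Proof.
move=> cE cS; rewrite in_K cE /=; have := even_dot cE oE; rewrite /dot.
have [pc|pc] := boolP (p \in supp c); last first.
  move=> _; apply/disjoint_notinP => i ic; apply/negP => io.
  have ip : i != p by apply: contraNneq pc => <-.
  by have := cS i; rewrite in_setD1 ip io ic => /(_ isT).
rewrite (_ : _ :&: _ = [set p]) ?cards1 //; apply/setP=> i; rewrite in_setI in_set1.
have [->|ip] := eqVneq i p; first by rewrite pc po.
by apply/negbTE/andP => -[ic io]; have := cS i; rewrite in_setD1 ip io ic => /(_ isT).
Qed.

(** Membership in [K] amounts to vanishing at seven points of the octad, where all 2^7 patterns
    occur equally often. *)
Let cardK : #|K| = 32%N.
Proof.
have := card_fibre 0 linE subE (small_free _) => /(_ S7); rewrite cardS7 cardE => /(_ isT) /eqP.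
rewrite (expnD 2 5 7) eqn_pmul2r // => /eqP cS; rewrite -[RHS]/(2 ^ 5)%N -cS.
apply: eq_card => c; rewrite in_K [RHS]in_set.
apply: andb_id2l => cE; apply/idP/forall_inP => [dc i /setD1P[_ io]|ag].
  by rewrite (disjointFl dc io) supp0 inE.
by have := inK_S7 cE; rewrite in_K cE; apply=> i /ag/eqP ->; rewrite supp0 inE.
Qed.

(** No nonzero codeword c lies in [S9]: it would have weight 8 with at least 6 points in the octad,
    so c + o would be nonzero of weight at most 4. Hence a codeword can be prescribed on [S9], with
    value 1 at [q] only. *)
Let separates q r : q \notin supp o -> r \notin supp o -> q != r ->
  exists2 c, c \in K & (q \in supp c) != (r \in supp c).
Proof.
move=> qo ro qr; pose S9 := q |: (r |: S7).
have S9_free c : c \in E -> supp c \subset S9 -> c = 0.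
  move=> cE cS; have capS : supp c :\: supp o \subset [set q; r].
    apply/subsetP=> i /setDP[/(subsetP cS)]; rewrite !in_setU1 in_setD1 => + io.
    by rewrite (negbTE io) andbF orbF => ?; rewrite !inE.
  have le2 : (#|supp c :\: supp o| <= 2)%N.
    by rewrite (leq_trans (subset_leq_card capS)) // cards2 qr.
  have cap7 : (#|supp c :&: supp o| <= 7)%N.
    apply: (@leq_trans #|S7|); last by rewrite cardS7.
    apply/subset_leq_card/subsetP=> i /setIP[/(subsetP cS)].
    rewrite !in_setU1 => /or3P[/eqP-> | /eqP-> |//]; first by rewrite (negbTE qo).
    by rewrite (negbTE ro).
  apply: contraTeq isT => c0; have ge8 := distE cE c0.
  have co0 : c + o != 0.
    apply: contraTneq po => co0; have -> : o = c by rewrite -(word_addKr c o) co0 addr0.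
    apply/negP => /(subsetP cS); rewrite !in_setU1 in_setD1 eqxx /= orbF.
    by case/orP=> /eqP pE; [move: qo | move: ro]; rewrite -pE po.
  have := distE (addE cE oE) co0; have := weightD c o; have := dblE cE.
  have := cardsID (supp o) (supp c); rewrite -weightE wo.
  by move: (weight (c + o)) (weight c) #|_| #|_| ge8 cap7 le2; clear; lia.
have [c cE cw] := fibre_exists (word_of [set q]) linE subE S9_free.
have qS : q \in S9 by rewrite in_setU1 eqxx.
have rS : r \in S9 by rewrite !in_setU1 eqxx orbT.
exists c; last first.
  by rewrite !cw // supp_word_of !in_set1 eqxx [r == q]eq_sym (negbTE qr).
apply: inK_S7 => // i iS; rewrite cw ?in_setU1 ?iS ?orbT // supp_word_of in_set1.
by apply: contraNF qo => /eqP <-; case/setD1P: iS.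
Qed.

Let J := ones 24 + o.

Let in_J i : (i \in supp J) = (i \notin supp o).
Proof. by rewrite in_suppD supp_ones. Qed.

Let JK : J \in K.
Proof.
rewrite in_K addE //=; apply/disjoint_notinP=> i.
by rewrite in_J.
Qed.

(** The five-dimensional [K] is generated by the complement [J] of the octad and four further words.
    Since [K] separates the points outside the octad and [J] does not, the four words do. *)
Lemma labelling_functions : exists f : 'I_4 -> word 24, (forall a, f a \in K) /\
  {in ~: supp o &, injective (fun i => [ffun a => i \in supp (f a)])}.
Proof.
pose A : code 24 := [set 0; J].
have J0 : J != 0.
  have /set0Pn[i] : ~: supp o != set0.
    by rewrite -card_gt0 cardsCs setCK -weightE wo card_ord.
  by rewrite inE -in_J => iJ; apply: contraTneq iJ => ->; rewrite supp0 inE.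
have linA : linear_code A.
  split=> [|u v]; rewrite !inE ?eqxx // => /orP[]/eqP-> /orP[]/eqP->;
    by rewrite ?addr0 ?add0r ?word_addrr eqxx ?orbT.
have sAK : A \subset K by rewrite subUset !sub1set JK; case: linK => ->.
have cK : #|K| = (2 ^ 4 * #|A|)%N by rewrite cardK cards2 eq_sym J0.
have [t [st tK gen]] := generators linA linK sAK cK.
exists (fun a => t`_a); split=> [a|q r]; first by rewrite tK // mem_nth // st.
rewrite !in_setC => qo ro /ffunP eqf; apply/eqP; apply: contraT => qr.
have [c cK' /negP[]] := separates qo ro qr.
pose Q : code 24 := [set c | (q \in supp c) == (r \in supp c)].
have inQ c' : (c' \in Q) = ((q \in supp c') == (r \in supp c')) by rewrite in_set.
suff /subsetP/(_ c cK') : K \subset Q by rewrite inQ.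
apply: gen => [||x /(nthP 0)[a]].
- split=> [|u v]; first by rewrite inQ supp0 !inE.
  by rewrite !inQ !in_suppD => /eqP-> /eqP->.
- by rewrite subUset !sub1set !inQ supp0 !in_J (negbTE qo) (negbTE ro) !in_set0.
by rewrite st inQ => lta <-; have := eqf (Ordinal lta); rewrite !ffunE => ->.
Qed.

(** The four functions label the sixteen points injectively, hence bijectively, by F_2^4. They
    become the coordinate functions, and [J] becomes the all-one row. *)
Lemma octad_standardises : exists2 s : 'S_24, s ord0 = p &
  {in reed_muller, forall r, word_of_bits (shifted r) \in permute_code s E}.
Proof.
have [f [fK injf]] := labelling_functions.
pose lam i : {ffun 'I_4 -> bool} := [ffun a => i \in supp (f a)].
have lam_onto y : exists2 i, i \notin supp o & lam i = y.
  have : y \in lam @: (~: supp o).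
    rewrite (_ : lam @: _ = setT) ?inE //; apply/eqP; rewrite eqEcard subsetT card_in_imset //.
    by rewrite cardsT card_ffun card_bool card_ord [#|~: _|]cardsCs setCK -weightE wo card_ord.
  by case/imsetP=> i; rewrite in_setC => io ->; exists i.
pose digits (x : nat) : {ffun 'I_4 -> bool} := [ffun a : 'I_4 => odd (x %/ 2 ^ a)].
have [g gP] : exists g : 'I_16 -> 'I_24, forall x, g x \notin supp o /\ lam (g x) = digits x.
  apply: (@fin_all_exists _ _ (fun (x : 'I_16) i => i \notin supp o /\ lam i = digits x)) => x.
  by have [i io e] := lam_onto (digits x); exists i.
have lt_lab x : x \in labels -> (x < 16)%N.
  by move: x; apply/allP; vm_compute.
pose h (x : nat) := g (inord x).
have ho x : h x \notin supp o by case: (gP (inord x)).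
have hf x (a : 'I_4) : x \in labels -> (h x \in supp (f a)) = odd (x %/ 2 ^ a).
  move=> /lt_lab lt16; case: (gP (inord x)) => _ /ffunP/(_ a); rewrite !ffunE => ->.
  by rewrite inordK.
have uniq_h : uniq (map h labels).
  pose bits_of i := [seq i \in supp (f a) | a <- enum 'I_4].
  apply: (@map_uniq _ _ bits_of); rewrite -map_comp.
  pose dig x := [seq odd (x %/ 2 ^ a) | a <- iota 0 4]%N.
  rewrite (_ : map _ labels = map dig labels); first by vm_compute.
  apply/eq_in_map => x xl; rewrite /dig -val_enum_ord -map_comp.
  by apply: eq_map => a; rewrite /= hf.
have size_O : size (enum S7) = 7%N by rewrite -fintype.cardE.
have [hs hsE] : exists hs, hs = map h labels by exists (map h labels).
(* The new order of the points: [p], the rest of the octad, then the other points in the order of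
   [labels]. *)
pose coords := p :: enum S7 ++ hs; rewrite -hsE in uniq_h.
have mem_h i : i \in hs -> i \notin supp o by rewrite hsE => /mapP[x _ ->].
have size_c : size coords = 24%N by rewrite /coords -cat_cons size_cat hsE size_map /= size_O.
have permP : is_perm_list (map val coords).
  rewrite /is_perm_list size_map size_c (map_inj_uniq val_inj) all_map; apply/and3P; split.
  - by [].
  - rewrite /coords cons_uniq cat_uniq enum_uniq uniq_h andbT mem_cat mem_enum in_setD1 eqxx /=.
    apply/andP; split; first by apply/negP => /mem_h; rewrite po.
    by apply/hasPn => i /mem_h io; rewrite mem_enum in_setD1 (negbTE io) andbF.
  by apply/allP => i _; apply: ltn_ord.
have [s sP] := perm_of_list permP.
have sE (i : 'I_24) : s i = nth p coords i.
  by apply: val_inj; rewrite /= sP (nth_map p) // size_c.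
exists s; first by rewrite sE.
have moved u : u \in K -> forall r, r = [seq h x \in supp u | x <- labels] ->
    word_of_bits (shifted r) \in permute_code s E.
  rewrite in_K => /andP[uE uo] r rE; apply/imsetP; exists u => //.
  apply: supp_inj; apply/setP=> i; rewrite in_supp_bits in_supp_col_perm sE.
  rewrite /shifted nth_cat size_nseq nth_nseq; have [lt8|ge8] := ltnP i 8.
    apply/esym; rewrite (disjointFl uo) //.
    rewrite /coords -cat_cons nth_cat [size (p :: _)]/= size_O lt8.
    have : nth p (p :: enum S7) i \in p :: enum S7 by rewrite mem_nth //= size_O.
    by rewrite inE mem_enum => /predU1P[->|/setD1P[]].
  have lt16 : (i - 8 < size labels)%N by rewrite ltn_subLR // ltn_ord.
  rewrite /coords -cat_cons nth_cat [size (p :: _)]/= size_O ltnNge ge8 rE hsE.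
  by rewrite (nth_map 0%N) // (nth_map 0%N).
move=> r rR; have : r \in nseq 16 true :: [seq [seq odd (x %/ 2 ^ a) | x <- labels] | a <- iota 0 4]%N.
  exact: rR.
rewrite in_cons => /predU1P[->|/mapP[a]].
  apply: (moved J) => //; rewrite (eq_map (g := fun=> true)) // => x.
  by rewrite in_J ho.
rewrite mem_iota => lta ->; apply: (moved (f (Ordinal lta))) => //.
by apply/eq_in_map => x xl; rewrite hf.
Qed.

End Octad.

(** Control over the point sent to position 0 allows two such codes to be identified with the added
    coordinate fixed. *)
Theorem golay_like_unique :
  exists2 s : 'S_24, s ord0 = p & permute_code s E = code_of golay_code.
Proof.
have [o [oE wo po]] := octad_through; have [s0 s0p rmE] := octad_standardises oE wo po.
have [s1 s10 E1] := standardised_unique (golay_like_permute s0 golE) rmE.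
by exists (s1 * s0)%g; rewrite ?permM ?s10 // -permute_codeM.
Qed.

End Labelling.

(** * Codes of size 1288 *)

(** Distances in the punctured code are at least 7, and between words of equal weight they are
    even. *)
Lemma words_of_weight11 (E : code 24) (i : 'I_24) :
    linear_code E -> #|E| = (2 ^ 12)%N ->
    {in E, forall x, x != 0 -> (8 <= weight x)%N} ->
  constant_weight_code 8 11 (words_of_weight 11 (puncture i E)) /\
  #|words_of_weight 11 (puncture i E)| = 1288%N.
Proof.
move=> linE cE distE; have linP := linear_puncture i linE.
have distP : {in puncture i E, forall x, x != 0 -> (7 <= weight x)%N} := dist_puncture distE.
split; last exact: (perfect_weight11 linP (card_puncture i linE cE distE) distP).
split=> [u|u v]; first by rewrite inE => /andP[_ /eqP].
rewrite !in_set => /andP[uP /eqP wu] /andP[vP /eqP wv] uv.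
have uvP : u + v \in puncture i E by case: linP => _; apply.
have uv0 : u + v != 0 by apply: contraNneq uv => uv0; rewrite -(word_addrK v u) /= uv0 add0r.
have := distP _ uvP uv0; have := weightD u v; rewrite hammingE wu wv.
by move: (weight _) #|_|; clear; lia.
Qed.

(** The words of [C] are among the words of weight 11 of the punctured code, and both sets have 1288
    elements. *)
Lemma mem_extension (C : code 23) (E : code 24) : constant_weight_code 8 11 C ->
    #|C| = 1288%N -> golay_like E -> {in C, forall u, extend u \in E} ->
  forall u, (u \in C) = (weight u == 11)%N && (extend u \in E).
Proof.
move=> [wC _] cC [linE cE _ distE] CE u.
rewrite (_ : C = [set u | (weight u == 11)%N && (extend u \in E)]) ?in_set //.
have [_ c11] := words_of_weight11 ord_max linE cE distE.
apply/eqP; rewrite eqEcard cC -c11; apply/andP; split.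
  by apply/subsetP=> x xC; rewrite in_set wC ?eqxx ?CE.
apply/subset_leq_card/subsetP=> x; rewrite !in_set => /andP[-> xE]; rewrite andbT.
by apply/imsetP; exists (extend x); rewrite ?col'_extend.
Qed.

Lemma perm_fixing_last (s : 'S_24) : s ord_max = ord_max ->
  exists t : 'S_23, forall j, s (lift ord_max j) = lift ord_max (t j).
Proof.
move=> s_max; pose f j := odflt j (unlift ord_max (s (lift ord_max j))).
have fE j : s (lift ord_max j) = lift ord_max (f j).
  rewrite /f; case: unliftP => [//|/= sj]; have := neq_lift ord_max j.
  by rewrite -(inj_eq (@perm_inj _ s)) sj s_max eqxx.
have injf : injective f.
  by move=> j k eq_f; apply: (@lift_inj _ ord_max); apply: (@perm_inj _ s); rewrite !fE eq_f.
by exists (perm injf) => j; rewrite permE.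
Qed.

Lemma extend_col_perm (s : 'S_24) (t : 'S_23) u :
    s ord_max = ord_max -> (forall j, s (lift ord_max j) = lift ord_max (t j)) ->
  extend (col_perm t u) = col_perm s (extend u).
Proof.
move=> s_max st; apply/rowP=> i; rewrite !mxE; case: (unliftP ord_max i) => [j ->|->].
  by rewrite st liftK mxE.
by rewrite s_max unlift_none.
Qed.

(** Both spans are carried to the reference code with the added point going to the same place, so
    the composite permutation fixes that point and restricts to the 23 coordinates. *)
Lemma code_unique (C D : code 23) :
    constant_weight_code 8 11 C -> #|C| = 1288%N ->
    constant_weight_code 8 11 D -> #|D| = 1288%N ->
  exists s : 'S_23, D = permute_code s C.
Proof.
move=> cwC cC cwD cD.
have [E golE CE] := extends_to_golay_like cwC cC; have [F golF DF] := extends_to_golay_like cwD cD.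
have [s s0 sE] := golay_like_unique ord_max golE; have [t t0 tF] := golay_like_unique ord_max golF.
have FE : permute_code (t^-1 * s)%g E = F.
  by rewrite -permute_codeM sE -tF permute_codeM mulVg; apply/setP=> u;
    rewrite mem_permute_code invg1 col_perm1.
have r_max : (t^-1 * s)%g ord_max = ord_max by rewrite permM -{1}t0 permK.
have [r rP] := perm_fixing_last r_max; exists r; apply/eqP; rewrite eq_sym eqEcard.
rewrite card_permute_code cC cD leqnn andbT; apply/subsetP=> _ /imsetP[u uC ->].
rewrite (mem_extension cwD cD golF DF) weight_col_perm (extend_col_perm _ r_max rP) -FE.
by rewrite imset_f ?CE // andbT; case: cwC => /(_ u uC)->.
Qed.

Lemma golay_words_of_weight11 (B : code 23) : is_golay B ->
  constant_weight_code 8 11 (words_of_weight 11 B) /\ #|words_of_weight 11 B| = 1288%N.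
Proof.
case=> V [i [[dimV [distV _]] ->]].
apply: words_of_weight11; [exact: linear_code_of | by rewrite card_code_of dimV|].
move=> x xV x0; have [V0 _] := linear_code_of V.
by have := distV x 0 xV V0 x0; rewrite hammingE addr0.
Qed.

Local Close Scope ring_scope.

Theorem proposition4p2 :
  [/\ exists C : code 23, constant_weight_code 8 11 C /\ #|C| = 1288,
      forall C D : code 23,
        constant_weight_code 8 11 C -> #|C| = 1288 ->
        constant_weight_code 8 11 D -> #|D| = 1288 ->
        exists s : 'S_23, D = permute_code s C,
      exists B : code 23, is_golay B
    & forall B : code 23, is_golay B ->
        constant_weight_code 8 11 (words_of_weight 11 B) /\
        #|words_of_weight 11 B| = 1288].
Proof.
have golayB : is_golay (puncture ord_max (code_of golay_code)).
  by exists golay_code, ord_max; split; first exact: is_extended_golay_code.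
split; [| exact: code_unique | by exists (puncture ord_max (code_of golay_code)) |].
  by eexists; apply: golay_words_of_weight11 golayB.
exact: golay_words_of_weight11.
Qed.
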